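(* Let $X=(X(t))_{t\ge0}$ be a pure jump strong Markov process on a complete separable metric space $S$ with transition rate kernel $q(x,dy)$ and stationary distribution $\pi$. Let $A\subset S$ be measurable. Suppose that for some $t_0>0$ the law $P_\pi$ of $X$ with initial distribution $\pi$ is ergodic with respect to the time shift $X\mapsto F_{t_0}X$, where $(F_{t_0}x)(t)=x(t_0+t)$. If $q_{\mathrm{ex}}(A)>0$ then the distribution $\mu_A$ is stationary for $(Y_n)_{n\ge1}$, and if $(\tau_n(A,A^c)/n)_{n}$ is uniformly integrable when $X(0)$ has distribution $\mu_A$ then $$E_{\mu_A}[\tau_{\mathrm{ex}}(A)]=1/q_{\mathrm{ex}}(A).$$
   Context: Transition rate kernel: for $x\in S$, Borel $B\subset S$ and small $h>0$, $P(X(t+h)\in B\mid X(t)=x)=h\,q(x,B)+O(h^2)$. $P_\psi,E_\psi$ denote probability and expectation when $X(0)$ has distribution $\psi$. For $A,B\subset S$: transition times from $A$ into $B$ are $\tau_0(A,B)=0$, $\tau_n(A,B)=\inf\{t>\tau_{n-1}(A,B)\colon X(t^-)\in A,\ X(t)\in B\}$. The stationary transition rate is $q_\pi(A,B)=\int_{x\in A}\pi(dx)q(x,B)$. Write $\tau_{\mathrm{ex}}(A)=\tau_1(A,A^c)$ (first exit time from $A$), $q_{\mathrm{ex}}(A)=q_\pi(A,A^c)$ (stationary exit rate), and let $Y_n=X(\tau_n(A,A^c))$, $n\ge1$, be the process of exit states (a Markov chain). If $q_{\mathrm{ex}}(A)>0$, $\mu_A$ is the distribution supported on $A^c$ given by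 $$\mu_A(B)=\frac{q_\pi(A,B\cap A^c)}{q_\pi(A,A^c)}.$$ *)

(* Defs.v *)
From HB Require Import structures.
From mathcomp Require Import all_boot all_order all_algebra.
From mathcomp Require Import all_classical all_reals all_analysis.
From mathcomp Require Import measurable_realfun.

Set Implicit Arguments.
Unset Strict Implicit.
Unset Printing Implicit Defensive.
Import Order.TTheory GRing.Theory Num.Theory.
Import numFieldNormedType.Exports.

Local Open Scope classical_set_scope.
Local Open Scope ring_scope.
Local Open Scope ereal_scope.

(* The library's [completePseudoMetricType] need not be separated. The base
   point is required by the library's generated sigma-algebras. *)
#[short(type="completeMetricType")]
HB.structure Definition CompleteMetric (R : numDomainType) :=
  {T of Complete T & Metric R T & Pointed T}.

Definition separable_space (T : topologicalType) :=
  exists D : set T, countable D /\ dense D.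

Definition borel (T : ptopologicalType) := g_sigma_algebraType (@open T).

HB.instance Definition _ (T : ptopologicalType) :=
  Measurable.on (borel T).

Section paths.
Context {R : realType} {T : Type}.
Implicit Types (x : {nonneg R} -> T) (t : {nonneg R}).

(* For t > 0: x is constant, equal to y, on a left neighbourhood of t. On the
   paths below, this says that x(t^-) = y. *)
Definition left_value x t (y : T) :=
  exists2 e : R, (0 < e)%R &
    forall s : {nonneg R}, (t%:num - e < s%:num < t%:num)%R -> x s = y.

(* Right-continuous, piecewise constant, and by compactness with finitely many
   jumps in each bounded interval (in particular without explosion). *)
Definition is_jump_path x :=
  (forall t, exists2 e : R, (0 < e)%R &
     forall s : {nonneg R}, (t%:num <= s%:num < t%:num + e)%R -> x s = x t) /\
  (forall t, (0 < t%:num)%R -> exists y, left_value x t y).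

End paths.

Record jump_path (R : realType) (T : Type) := JumpPath {
  path_fun :> {nonneg R} -> T ;
  path_funP : is_jump_path path_fun }.

Section time_shift.
Context {R : realType} {T : Type}.

Lemma shift_is_jump_path (h : {nonneg R}) (x : jump_path R T) :
  is_jump_path (fun t : {nonneg R} => x (h%:num + t%:num)%:nng%R).
Proof.
have [xr xl] := path_funP x; split=> t.
- have [e e0 He] := xr (h%:num + t%:num)%:nng%R.
  exists e => // s /andP[ts ste]; apply: He => /=.
  by rewrite lerD2l ts /= -addrA ltrD2l.
- move=> t0; have [|y [e e0 He]] := xl (h%:num + t%:num)%:nng%R.
    by rewrite /= ltr_wpDl.
  exists y, e => // s /andP[ts st]; apply: He => /=.
  by rewrite -addrA ltrD2l ts ltrD2l.
Qed.

Definition time_shift (h : {nonneg R}) (x : jump_path R T) : jump_path R T :=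
  JumpPath (shift_is_jump_path h x).

Lemma cst_is_jump_path (y : T) : is_jump_path (fun _ : {nonneg R} => y).
Proof. by split=> [t|t _]; [exists 1%R|exists y, 1%R]. Qed.

End time_shift.

Definition time_of {R : realType} (e : \bar R) : {nonneg R} :=
  `|fine e|%:nng%R.

Section path_space.
Context {R : realType} {S : completeMetricType R}.

Definition coord_events (I : set {nonneg R}) : set (set (jump_path R S)) :=
  [set E | exists (s : {nonneg R}) (C : set (borel S)),
     [/\ I s, measurable C & E = [set w : jump_path R S | C (w s)]]].

End path_space.

Section path_space_instances.
Context (R : realType) (S : completeMetricType R).

HB.instance Definition _ := gen_eqMixin (jump_path R S).
HB.instance Definition _ := gen_choiceMixin (jump_path R S).
HB.instance Definition _ := isPointed.Build (jump_path R S)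
  (JumpPath (cst_is_jump_path (@point S))).

Definition path_space := g_sigma_algebraType (@coord_events R S setT).
HB.instance Definition _ := Measurable.on path_space.

End path_space_instances.
Arguments path_space {R} S.

Section transition_times.
Context {R : realType} {S : completeMetricType R}.
Implicit Types (A B : set (borel S)) (w : path_space S).

Fixpoint tau A B (n : nat) w : \bar R :=
  if n is m.+1 then
    ereal_inf [set t%:num%:E | t in [set t : {nonneg R} |
      [/\ tau A B m w < t%:num%:E,
          (exists2 y, left_value w t y & A y) & B (w t)]]]
  else 0.

Definition tau_ex A w := tau A (~` A) 1 w.

(* Meaningful only where the n-th transition time is finite. *)
Definition exit_state A (n : nat) w : borel S :=
  w (time_of (tau A (~` A) n w)).

End transition_times.

Section strong_markov.
Context {R : realType} {S : completeMetricType R}.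

Definition natural_filtration (t : {nonneg R}) : set (set (path_space S)) :=
  <<s coord_events [set s : {nonneg R} | (s%:num <= t%:num)%R] >>.

Definition stopping_time (T : path_space S -> \bar R) :=
  (forall w, 0 <= T w) /\
  (forall t : {nonneg R},
     natural_filtration t [set w | T w <= t%:num%:E]).

Definition stopped_events (T : path_space S -> \bar R) :
    set (set (path_space S)) :=
  [set E | measurable E /\ forall t : {nonneg R},
     natural_filtration t (E `&` [set w | T w <= t%:num%:E])].

Section law.
Variables (P : R.-pker (borel S) ~> (path_space S))
  (psi : {measure set (borel S) -> \bar R}).

(* The measure P_psi on paths, where P x stands for P_x. *)
Definition law (E : set (path_space S)) : \bar R := \int[psi]_x P x E.

Let law0 : law set0 = 0.
Proof.
by rewrite /law; under eq_integral do rewrite measure0; rewrite integral0.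
Qed.

Let law_ge0 E : 0 <= law E.
Proof. by apply: integral_ge0 => x _; exact: measure_ge0. Qed.

Let law_sigma_additive : semi_sigma_additive law.
Proof.
move=> F mF tF mUF; rewrite [X in _ --> X](_ : _ =
    \int[psi]_x (\sum_(n <oo) P x (F n))); last first.
  apply: eq_integral => x _; apply/esym/cvg_lim => //.
  exact/measure_semi_sigma_additive.
rewrite integral_nneseries//.
- by apply: is_cvg_nneseries => n _ _; exact: law_ge0.
- by move=> n; exact/measurable_kernel.
Qed.

HB.instance Definition _ := isMeasure.Build _ _ _ law
  law0 law_ge0 law_sigma_additive.

End law.

Definition strong_markov_process (P : R.-pker (borel S) ~> (path_space S)) :=
  (forall x : borel S, P x [set w : path_space S | w 0%:nng%R = x] = 1) /\
  (forall (psi : probability (borel S) R) (T : path_space S -> \bar R)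
     (E G : set (path_space S)),
   stopping_time T -> stopped_events T E -> measurable G ->
   law P psi [set w | [/\ E w, T w < +oo & G (time_shift (time_of (T w)) w)]] =
   \int[law P psi]_(w in [set w | E w /\ T w < +oo])
      P (w (time_of (T w))) G).

Definition stationary_distribution (P : R.-pker (borel S) ~> (path_space S))
    (pi : probability (borel S) R) :=
  forall (t : {nonneg R}) (B : set (borel S)), measurable B ->
    law P pi [set w : path_space S | B (w t)] = pi B.

(* By homogeneity P(X(t+h) \in B | X(t) = x) = P_x(X(h) \in B). The expansion
   is for x \notin B: the left-hand side tends to 1 when x \in B. The constants
   in O(h^2) may depend on x and B. *)
Definition transition_rate_kernel (P : R.-pker (borel S) ~> (path_space S))
    (q : R.-ker (borel S) ~> (borel S)) :=
  forall (x : borel S) (B : set (borel S)), measurable B -> ~ B x ->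
  exists C d : R, (0 < d)%R /\
    forall h : {nonneg R}, (0 < h%:num < d)%R ->
      `| P x [set w : path_space S | B (w h)] - h%:num%:E * q x B |
        <= (C * h%:num ^+ 2)%:E.

End strong_markov.

Section rates.
Context {R : realType} {S : completeMetricType R}.
Variables (q : R.-ker (borel S) ~> (borel S)) (pi : probability (borel S) R).

Definition stationary_rate (A B : set (borel S)) : \bar R :=
  \int[pi]_(x in A) q x B.

Definition exit_rate (A : set (borel S)) := stationary_rate A (~` A).

(* As 1 / +oo = 0 and 0 * +oo = 0, this is a distribution exactly when the
   exit rate is positive and finite, and it is the null measure otherwise. *)
Definition exit_distribution (A : set (borel S)) (mA : measurable A)
    (B : set (borel S)) : \bar R :=
  stationary_rate A (B `&` ~` A) / exit_rate A.

Section exit_distribution_measure.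
Variables (A : set (borel S)) (mA : measurable A).
Local Notation mu := (exit_distribution mA).

Let exit_rate_ge0 : 0 <= exit_rate A.
Proof. by apply: integral_ge0. Qed.

Let mu0 : mu set0 = 0.
Proof.
rewrite /exit_distribution /stationary_rate set0I.
by under eq_integral do rewrite measure0; rewrite integral0 mul0e.
Qed.

Let mu_ge0 B : 0 <= mu B.
Proof. by rewrite mule_ge0 ?inve_ge0 ?integral_ge0. Qed.

Let mu_sigma_additive : semi_sigma_additive mu.
Proof.
move=> F mF tF mUF.
rewrite [X in _ --> X](_ : _ = \sum_(n <oo) mu (F n)); last first.
  rewrite /exit_distribution /stationary_rate setI_bigcupl.
  have mFA n : measurable (F n `&` ~` A).
    by apply: measurableI => //; exact: measurableC.
  transitivity
    (\int[pi]_(x in A) (\sum_(n <oo) q x (F n `&` ~` A)) / exit_rate A).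
    congr (_ / _); apply: eq_integral => x _; apply/esym/cvg_lim => //.
    apply: measure_semi_sigma_additive => //.
      exact: trivIset_setIr.
    exact: bigcup_measurable.
  have mq B : measurable B -> measurable_fun A (q ^~ B).
    move=> mB; apply: (measurable_funS measurableT) => //.
    exact: measurable_kernel.
  rewrite integral_nneseries//; last by move=> n; exact: mq.
  have rate_le n : \int[pi]_(x in A) q x (F n `&` ~` A) <= exit_rate A.
    apply: ge0_le_integral => //.
    - exact: mq.
    - by apply: mq; exact: measurableC.
    - move=> x _; apply: le_measure; rewrite ?inE//.
      exact: measurableC.
  case: (inveP (exit_rate A)) exit_rate_ge0 rate_le => [_ rate0|_ _|//|r _ _ _].
  - have F0 n : \int[pi]_(x in A) q x (F n `&` ~` A) = 0.
      by apply/eqP; rewrite eq_le rate0 integral_ge0.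
    rewrite eseries0 ?mul0e; last by move=> n _ _; exact: F0.
    by rewrite eseries0// => n _ _; rewrite F0 mul0e.
  - by rewrite mule0 eseries0// => n _ _; rewrite mule0.
  rewrite muleC -nneseriesZl; last by move=> n _; exact: integral_ge0.
  by apply: eq_eseriesr => n _; rewrite muleC.
by apply: is_cvg_nneseries => n _ _; exact: mu_ge0.
Qed.

HB.instance Definition _ := isMeasure.Build _ _ _ mu
  mu0 mu_ge0 mu_sigma_additive.

End exit_distribution_measure.

Lemma exit_distribution_setT (A : set (borel S)) (mA : measurable A) :
  0 < exit_rate A < +oo -> exit_distribution mA setT = 1.
Proof.
move=> /andP[q0 qoo]; rewrite /exit_distribution setTI divee// ?gt_eqF//.
by rewrite ge0_fin_numE// ltW.
Qed.

End rates.

Definition ergodic d (T : measurableType d) (R : realType)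
    (m : {measure set T -> \bar R}) (F : T -> T) :=
  forall E : set T, measurable E -> F @^-1` E = E -> m E = 0 \/ m E = 1.

Definition uniformly_integrable d (T : measurableType d) (R : realType)
    (m : {measure set T -> \bar R}) (f : nat -> T -> \bar R) :=
  (fun K : R => ereal_sup (range (fun n =>
     \int[m]_(w in [set w | K%:E <= `|f n w|]) `|f n w|)))
  @ +oo%R --> (0 : \bar R).

(* If X(0) has distribution mu, then all transition times are almost surely
   finite (take B := setT) and every Y_n has distribution mu. The case n = 1 is
   invariance of mu under the transition kernel x |-> P_x(Y_1 \in .) of the
   Markov chain (Y_n). *)
Definition stationary_for_exits (R : realType) (S : completeMetricType R)
    (P : R.-pker (borel S) ~> (path_space S)) (A : set (borel S))
    (mu : {measure set (borel S) -> \bar R}) :=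
  forall (n : nat) (B : set (borel S)), (1 <= n)%N -> measurable B ->
    law P mu [set w | tau A (~` A) n w < +oo /\ B (exit_state A n w)] = mu B.

(* Main.v *)
(* The law of X under P_mu is, up to the factor q_ex(A), the Palm measure of the
   exits from A under P_pi: for an event G, the expected number of exit times
   tau_n <= t of the stationary process whose future lies in G is
   t q_ex(A) P_mu(G).  By the strong Markov property this reduces to counting the
   exits into a set B, with expectation t q_pi(A, B \ A), which follows from
   stationarity by discretizing [0, t] dyadically.

   Replacing the futures at tau_1, ..., tau_N by the futures n exits later
   changes the count by at most n, so stationarity follows by letting t tend to
   infinity.  The mean exit time is obtained in the same way from the telescoping
   sum of the gaps tau_(n+1) - tau_n: t q_ex(A) E_mu[tau_1] is the P_pi-mean of
   the time from the first exit to the first exit after t.  Ergodicity is only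
   used to see that an exit occurs almost surely under P_pi; Kac's argument then
   gives q_ex(A) E_mu[tau_1] = 1 without an ergodic theorem.

   If q_ex(A) is infinite, mu is the null measure and 1 / q_ex(A) = 0. *)

Require Import Defs.
From HB Require Import structures.
From mathcomp Require Import all_boot all_order all_algebra.
From mathcomp Require Import all_classical all_reals all_analysis.
From mathcomp Require Import measurable_realfun ring lra.

Set Implicit Arguments.
Unset Strict Implicit.
Unset Printing Implicit Defensive.
Import Order.TTheory GRing.Theory Num.Theory.
Import numFieldNormedType.Exports.

Local Open Scope classical_set_scope.
Local Open Scope ring_scope.
Local Open Scope ereal_scope.

Local Arguments tau : simpl never.

(** * Exit times of a path *)

Section exit_times.
Context {R : realType} {S : completeMetricType R}.
Implicit Types (A B : set (borel S)) (w : path_space S) (s t : {nonneg R}).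

(** At time 0 [left_value] holds vacuously, so this notion is meaningful for [0 < t] only; [tau]
    never counts time 0, since exits must come after [tau A B 0 w = 0]. *)
Definition exit_time A w t :=
  (exists2 y, left_value w t y & A y) /\ ~ A (w t).

(** The exit is at the supremum [u] of the times in [[s, t]] spent in [A]. By right-continuity the
    path is outside [A] at [u]; its left value at [u] is taken at times of [Z] just before [u],
    hence lies in [A]. *)
Lemma exit_time_between A w s t : (s%:num < t%:num)%R -> A (w s) -> ~ A (w t) ->
  exists2 u : {nonneg R}, (s%:num < u%:num <= t%:num)%R & exit_time A w u.
Proof.
move=> st As At.
have [wr wl] := path_funP w.
pose Z := [set r : R | exists u : {nonneg R},
  [/\ u%:num = r, (s%:num <= r <= t%:num)%R & A (w u)]].
have Zs : Z s%:num by exists s; rewrite lexx ltW.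
have ubZ : ubound Z t%:num by move=> r [u [_ /andP[_]]].
have supZ : has_sup Z by split; [exists s%:num|exists t%:num].
have sZ : (s%:num <= sup Z)%R by exact: ub_le_sup supZ.2 _ Zs.
have Zt : (sup Z <= t%:num)%R by apply: ge_sup => //; exists s%:num.
have u0 : (0 <= sup Z)%R by apply: le_trans sZ.
pose u := NngNum u0.
have uE : u%:num = sup Z by [].
have nAu : ~ A (w u).
  move=> Au.
  have ut : (u%:num < t%:num)%R.
    rewrite lt_neqAle uE Zt andbT; apply/eqP => ut; apply: At.
    by rewrite (_ : t = u)//; apply/val_inj; rewrite /= -ut.
  have [e e0 He] := wr u.
  pose r := Num.min (u%:num + e / 2)%R t%:num.
  have ur : (u%:num < r)%R by rewrite lt_min ut andbT ltrDl divr_gt0.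
  have r0 : (0 <= r)%R by apply: ltW; apply: le_lt_trans ur.
  have : Z r.
    exists (NngNum r0); split => //.
      by rewrite (le_trans sZ (ltW ur)) /= ge_min lexx orbT.
    rewrite He //= (ltW ur) /= gt_min ltrD2l ltr_pdivrMr// ltr_pMr// ?ltr1n//.
  by move/(ub_le_sup supZ.2); rewrite leNgt -uE ur.
have su : (s%:num < u%:num)%R.
  rewrite lt_neqAle sZ andbT; apply/eqP => su; apply: nAu.
  by rewrite (_ : u = s)//; apply/val_inj; rewrite /= -uE su.
exists u; first by rewrite su Zt.
split => //.
have [|y yl] := wl u; first by apply: le_lt_trans su.
exists y => //.
have [e e0 He] := yl.
have [r [v [vr /andP[sr rt] Av]] er] := sup_adherent e0 supZ.
rewrite -(He v)// vr er /= lt_neqAle ub_le_sup//; last 2 first.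
- exact: supZ.2.
- by exists v; rewrite sr rt.
rewrite andbT; apply/eqP => vu; apply: nAu.
by rewrite (_ : u = v)//; apply/val_inj; rewrite /= vr vu.
Qed.

Lemma exit_time_left A w t : exit_time A w t ->
  exists2 e : R, (0 < e)%R &
    forall s, (t%:num - e < s%:num < t%:num)%R -> A (w s).
Proof.
by move=> [[y [e e0 He] Ay] _]; exists e => // s /He ->.
Qed.

Lemma exit_time_just_before A w t (a : R) : (0 < t%:num)%R -> (a < t%:num)%R ->
  exit_time A w t -> exists2 s, (a < s%:num < t%:num)%R & A (w s).
Proof.
move=> t0 at_ /exit_time_left[e e0 He].
pose b := Num.max (Num.max a 0%R) (t%:num - e)%R.
have bt : (b < t%:num)%R by rewrite !gt_max at_ t0 ltrBlDr ltrDl.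
have b0 : (0 <= b)%R by rewrite !le_max lexx orbT.
have c0 : (0 <= (b + t%:num) / 2)%R by rewrite divr_ge0 ?addr_ge0.
have [bc ct] := midf_lt bt.
have ab : (a <= b)%R by rewrite !le_max lexx.
have eb : (t%:num - e <= b)%R by rewrite !le_max lexx orbT.
exists (NngNum c0) => /=; first by rewrite (le_lt_trans ab).
by apply: He => /=; rewrite (le_lt_trans eb).
Qed.

Lemma left_value_shift w s t y : (0 < t%:num)%R ->
  left_value (time_shift s w) t y <-> left_value w (s%:num + t%:num)%:nng%R y.
Proof.
move=> t0; split=> -[e e0 He].
(* The window has length at most [t], so it stays after [s], where the shifted path lives. *)
- exists (Num.min e t%:num); first by rewrite lt_min e0 t0.
  move=> u /andP[/= ul ur].
  have su : (s%:num <= u%:num)%R.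
    have : (Num.min e t%:num <= t%:num)%R by rewrite ge_min lexx orbT.
    by lra.
  have us0 : (0 <= u%:num - s%:num)%R by rewrite subr_ge0.
  have me : (Num.min e t%:num <= e)%R by rewrite ge_min lexx.
  rewrite -(He (NngNum us0)) /=; last by apply/andP; split; lra.
  by congr (w _); apply/val_inj; rewrite /= subrKC.
- exists e => // u /andP[tu ut]; apply: He => /=.
  by rewrite -addrA ltrD2l tu ltrD2l.
Qed.

Lemma exit_time_shift A w s t : (0 < t%:num)%R ->
  exit_time A (time_shift s w) t <-> exit_time A w (s%:num + t%:num)%:nng%R.
Proof.
move=> t0; split=> -[[y yl Ay] At]; split=> //; exists y => //.
- exact/left_value_shift.
- exact/left_value_shift.
Qed.

Lemma tau0 A B w : tau A B 0 w = 0. Proof. by []. Qed.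

Lemma tau_ge0 A n w : 0 <= tau A (~` A) n w.
Proof.
case: n => [|n]//; apply: le_ereal_inf_tmp => _ [t _ <-].
by rewrite lee_fin.
Qed.

Lemma tau_le A n w t : tau A (~` A) n w < t%:num%:E -> exit_time A w t ->
  tau A (~` A) n.+1 w <= t%:num%:E.
Proof. by move=> nt [Al Ar]; apply: ereal_inf_lbound; exists t. Qed.

Lemma tau_leS A n w : tau A (~` A) n w <= tau A (~` A) n.+1 w.
Proof. by apply: le_ereal_inf_tmp => _ [t [/ltW]] + _ _ <-. Qed.

Lemma tau_mono A m n w : (m <= n)%N ->
  tau A (~` A) m w <= tau A (~` A) n w.
Proof.
move=> /subnK <-; elim: (n - m)%N => [|k IH]; first by rewrite add0n.
by rewrite addSn; apply: le_trans IH _; exact: tau_leS.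
Qed.

(** Exit times do not accumulate from the right: the path is constant just after the infimum [s],
    while an exit needs a state in [A] shortly before it and a state outside [A] at it. *)
Lemma tau_attained A n w : tau A (~` A) n.+1 w < +oo ->
  exists t, [/\ tau A (~` A) n.+1 w = t%:num%:E, tau A (~` A) n w < t%:num%:E
    & exit_time A w t].
Proof.
move=> noo.
have n0 := tau_ge0 A n.+1 w.
have [s sE] : exists s : {nonneg R}, tau A (~` A) n.+1 w = s%:num%:E.
  have fn : tau A (~` A) n.+1 w \is a fin_num by rewrite ge0_fin_numE.
  have s0 : (0 <= fine (tau A (~` A) n.+1 w))%R by apply: fine_ge0.
  by exists (NngNum s0); rewrite fineK.
exists s.
suff [snt se] : tau A (~` A) n w < s%:num%:E /\ exit_time A w s by split.
have [wr wl] := path_funP w.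
have [e e0 He] := wr s.
set Z := [set t%:num%:E | t in [set t : {nonneg R} |
      [/\ tau A (~` A) n w < t%:num%:E,
          (exists2 y, left_value w t y & A y) & (~` A) (w t)]]].
have infZ : ereal_inf Z = s%:num%:E by exact: sE.
have [_ [t [tn tl tA] <-]] : exists2 x, Z x & x < (s%:num + e)%:E.
  by apply: ereal_inf_lt; rewrite infZ lte_fin ltrDl.
rewrite lte_fin => tse.
have : (s%:num <= t%:num)%R.
  by rewrite -lee_fin -infZ; apply: ereal_inf_lbound; exists t.
rewrite le_eqVlt => /predU1P[st|st].
  by rewrite (_ : s = t)//; exact/val_inj.
have t0 : (0 < t%:num)%R by apply: le_lt_trans st.
have [u /andP[su ut] Au] := exit_time_just_before t0 st (conj tl tA).
exfalso; apply: tA; rewrite He ?tse ?ltW//.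
by rewrite -(He u) // ltW //= (lt_trans ut).
Qed.

Lemma tau_num A n w : tau A (~` A) n w < +oo ->
  tau A (~` A) n w = (time_of (tau A (~` A) n w))%:num%:E.
Proof.
by move=> h; rewrite /= ger0_norm ?fine_ge0 ?tau_ge0// fineK// ge0_fin_numE ?tau_ge0.
Qed.

Lemma tau_lt A n w : tau A (~` A) n.+1 w < +oo ->
  tau A (~` A) n w < tau A (~` A) n.+1 w.
Proof. by move=> /tau_attained[t [-> ]]. Qed.

(** Each inequality carries an attained exit across the shift by [exit_time_shift]; an infinite time
    is attained nowhere, but bounds trivially. *)
Lemma tau_shift A n k w s : tau A (~` A) n w = s%:num%:E ->
  tau A (~` A) (n + k) w = s%:num%:E + tau A (~` A) k (time_shift s w).
Proof.
move=> ns; elim: k => [|k IH]; first by rewrite addn0 adde0.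
rewrite addnS; apply/eqP; rewrite eq_le; apply/andP; split.
- have [->|] := eqVneq (tau A (~` A) k.+1 (time_shift s w)) +oo.
    by rewrite addeC leey.
  rewrite -ltey => /tau_attained[t [-> kt et]].
  have t0 : (0 < t%:num)%R.
    by rewrite -lte_fin; apply: le_lt_trans kt; exact: tau_ge0.
  rewrite -EFinD; apply: (tau_le (t := (s%:num + t%:num)%:nng%R)).
    by rewrite IH EFinD lteD2lE.
  exact/exit_time_shift.
- have [->|] := eqVneq (tau A (~` A) (n + k).+1 w) +oo; first by rewrite leey.
  rewrite -ltey => /tau_attained[t [-> kt et]].
  have st : (s%:num < t%:num)%R.
    by rewrite -lte_fin -ns; apply: le_lt_trans kt; apply: tau_mono; exact: leq_addr.
  have u0 : (0 < t%:num - s%:num)%R by rewrite subr_gt0.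
  pose u := NngNum (ltW u0).
  have tu : t%:num = (s%:num + u%:num)%R by rewrite subrKC.
  have tE : t = (s%:num + u%:num)%:nng%R by exact/val_inj.
  rewrite tu EFinD leeD2lE//; apply: tau_le.
    by move: kt; rewrite IH tu EFinD lteD2lE.
  by apply/exit_time_shift => //; rewrite -tE.
Qed.

Lemma exit_state_shift A n k w s : tau A (~` A) n w = s%:num%:E ->
  tau A (~` A) (n + k) w < +oo ->
  exit_state A (n + k) w = exit_state A k (time_shift s w).
Proof.
move=> ns; rewrite (tau_shift k ns) => koo.
have kf : tau A (~` A) k (time_shift s w) \is a fin_num.
  rewrite ge0_fin_numE ?tau_ge0//; apply: le_lt_trans koo.
  by rewrite leeDr// lee_fin.
rewrite /exit_state (tau_shift k ns) /=; congr (w _); apply/val_inj => /=.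
by rewrite fineD//= !ger0_norm ?addr_ge0 ?fine_ge0 ?tau_ge0.
Qed.

Lemma exit_state_notin A n w : tau A (~` A) n.+1 w < +oo ->
  ~ A (exit_state A n.+1 w).
Proof.
move=> /tau_attained[t [ts _ [_]]]; rewrite /exit_state ts.
by rewrite (_ : time_of _ = t)//; apply/val_inj => /=; rewrite ger0_norm.
Qed.

(** Bounded exit times would increase to a finite limit, and the path is constant on a left
    neighbourhood of that limit, which leaves no room for exits. *)
Lemma tau_unbounded A w (t : R) : exists n, t%:E < tau A (~` A) n w.
Proof.
apply: contrapT => /forallNP ub.
have {}ub n : tau A (~` A) n w <= t%:E by rewrite leNgt; exact/negP.
have oo n : tau A (~` A) n w < +oo by rewrite (le_lt_trans (ub n)) ?ltry.
pose Z := [set r : R | exists n, tau A (~` A) n.+1 w = r%:E].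
have fE n : tau A (~` A) n w = (fine (tau A (~` A) n w))%:E.
  by rewrite fineK// ge0_fin_numE ?tau_ge0.
have Zf n : Z (fine (tau A (~` A) n.+1 w)) by exists n.
have supZ : has_sup Z.
  split; first by exists (fine (tau A (~` A) 1 w)).
  by exists t => r [n rE]; rewrite -lee_fin -rE.
have lesup n : tau A (~` A) n.+1 w <= (sup Z)%:E.
  by rewrite fE lee_fin; exact: ub_le_sup supZ.2 _ (Zf n).
have s0 : (0 < sup Z)%R.
  by rewrite -lte_fin; apply: lt_le_trans (lesup 0%N); exact: tau_lt (oo 1%N).
have [_ wl] := path_funP w.
have [y [e e0 He]] := wl (NngNum (ltW s0)) s0.
have [r [n nr] er] := sup_adherent e0 supZ.
(* Exit [n.+2] lies strictly between [sup Z - e] and [sup Z]: exit [n.+1] is already beyond the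
   former, and exit [n.+3] is at most the latter. *)
have [u [nu _ eu]] := tau_attained (oo n.+2).
have us : (u%:num < sup Z)%R.
  rewrite -lte_fin -nu; apply: lt_le_trans (lesup n.+2).
  exact: tau_lt (oo n.+3).
have eu' : (sup Z - e < u%:num)%R
  by rewrite (lt_trans er)// -lte_fin -nr -nu; exact: tau_lt (oo n.+2).
have u0 : (0 < u%:num)%R.
  by rewrite -lte_fin -nu; apply: le_lt_trans (tau_lt (oo n.+2)); exact: tau_ge0.
have [v /andP[ev vu] Av] := exit_time_just_before u0 eu' eu.
apply: eu.2; rewrite He; last by rewrite /= eu'.
rewrite -(He v) /=; first exact: Av.
by rewrite ev (lt_trans vu).
Qed.

End exit_times.

(** * Counting exits on dyadic grids *)

(** A choice function for the relation [C] is injective on the indices satisfying [P], and sizes of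
    duplicate-free lists are compared. *)
Lemma leq_count_matching (N M : nat) (P Q : nat -> bool) (C : nat -> nat -> Prop) :
  (forall n, (n < N)%N -> P n -> exists i, [/\ (i < M)%N, Q i & C n i]) ->
  (forall n m i, (n < m)%N -> P n -> P m -> C n i -> C m i -> False) ->
  (\sum_(n < N) P n <= \sum_(i < M) Q i)%N.
Proof.
move=> PQ inj.
have sumE K (F : nat -> bool) :
    (\sum_(n < K) F n)%N = size [seq n <- iota 0 K | F n].
  rewrite size_filter -sum1_count [RHS]big_mkcond /=.
  rewrite -(big_mkord xpredT (fun n => nat_of_bool (F n))) /index_iota subn0.
  by apply: eq_bigr => i _; case: (F i).
have /boolp.choice[f fP] : forall n, exists i, (n < N)%N -> P n ->
    [/\ (i < M)%N, Q i & C n i].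
  move=> n; have [nN|] := boolP (n < N)%N; last by exists 0%N.
  by have [/(PQ _ nN)[i]|] := boolP (P n); [exists i|exists 0%N].
rewrite !sumE -(size_map f); apply: uniq_leq_size.
- rewrite map_inj_in_uniq ?filter_uniq ?iota_uniq// => n m.
  rewrite !mem_filter !mem_iota !add0n /= => /andP[Pn nN] /andP[Pm mN] fnm.
  have [_ _ Cn] := fP _ nN Pn; have [_ _ Cm] := fP _ mN Pm.
  rewrite fnm in Cn.
  by have [nm|mn|//] := ltngtP n m; [case: (inj _ _ _ nm Pn Pm Cn Cm)|
    case: (inj _ _ _ mn Pm Pn Cm Cn)].
- move=> i /mapP[n]; rewrite !mem_filter !mem_iota !add0n /=.
  by move=> /andP[Pn nN] ->; have [-> ->] := fP _ nN Pn.
Qed.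

Section crossings.
Context {R : realType} {S : completeMetricType R}.
Implicit Types (A B : set (borel S)) (w : path_space S) (t : {nonneg R}).

(** The grid is fitted to [t]: its point of index [2 ^ j] is [t] itself, so events on the first
    [2 ^ j] steps are known at time [t]. *)
Definition grid t (j k : nat) : {nonneg R} := (t%:num * k%:R / 2 ^+ j)%:nng%R.

Definition step A B t (j k : nat) : set (path_space S) :=
  [set w | A (w (grid t j k)) /\ B (w (grid t j k.+1))].

Definition crossings A B t (j n : nat) w : nat :=
  (\sum_(i < n) (w \in step A B t j i))%N.

(** Index [n] stands for exit number [n.+1], so that series over [n] start with the first exit. *)
Definition exit_event A B t (n : nat) : set (path_space S) :=
  [set w | tau A (~` A) n.+1 w <= t%:num%:E /\ B (exit_state A n.+1 w)].

Lemma grid_num t j k : (grid t j k)%:num = (t%:num * k%:R / 2 ^+ j)%R.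
Proof. by []. Qed.

Lemma gridS t j k :
  ((grid t j k.+1)%:num = (grid t j k)%:num + t%:num / 2 ^+ j)%R.
Proof. by rewrite !grid_num -natr1 mulrDr mulr1 mulrDl. Qed.

Lemma grid_max t j : (grid t j (2 ^ j))%:num = t%:num.
Proof. by rewrite grid_num natrX mulfK// expf_neq0. Qed.

Lemma near_mesh t (e : R) : (0 < e)%R ->
  \forall j \near \oo, (t%:num / 2 ^+ j < e)%R.
Proof.
move=> e0.
have h : (fun j => t%:num / 2 ^+ j)%R @ \oo --> (0 : R)%R.
  have -> : (fun j => t%:num / 2 ^+ j)%R = geometric t%:num (2^-1)%R.
    by apply/funext => j; rewrite /= exprVn.
  by apply: cvg_geometric; rewrite ger0_norm ?invf_lt1 ?ltr1n ?invr_ge0.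
exact: (cvgr_lt _ h).
Qed.

(** Each crossing step contains an exit, and distinct steps contain distinct exits. *)
Lemma tau_crossings A t j n w :
  tau A (~` A) (crossings A (~` A) t j n w) w <= (grid t j n)%:num%:E.
Proof.
elim: n => [|n IH]; first by rewrite /crossings big_ord0 tau0 lee_fin.
rewrite /crossings big_ord_recr /= -/(crossings A (~` A) t j n w).
have le : ((grid t j n)%:num <= (grid t j n.+1)%:num)%R.
  by rewrite gridS lerDl divr_ge0.
case: (boolP (w \in _)) => [|_]; last first.
  by rewrite addn0 (le_trans IH)// lee_fin.
rewrite inE => -[Aw Bw]; rewrite addn1.
have lt : ((grid t j n)%:num < (grid t j n.+1)%:num)%R.
  rewrite lt_neqAle le andbT; apply/eqP => gg; apply: Bw.
  by rewrite (_ : grid t j n.+1 = grid t j n)//; exact/val_inj.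
have [u /andP[nu un] eu] := exit_time_between lt Aw Bw.
by rewrite (@le_trans _ _ u%:num%:E)// ?lee_fin// tau_le// (le_lt_trans IH).
Qed.

(** Once the mesh is small, the grid step around the exit starts at the left value, which lies in
    [A_ k] for large [k], and ends at the exit state. The last clause serves to tell the steps of
    different exits apart. *)
Lemma exit_event_crosses A B (A_ : (set (borel S))^nat) t n w :
  (forall x, A x -> \forall k \near \oo, A_ k x) ->
  exit_event A B t n w ->
  \forall k \near \oo, \forall j \near \oo, exists i, [/\ (i < 2 ^ j)%N,
    step (A_ k) B t j i w, (grid t j i)%:num%:E < tau A (~` A) n.+1 w &
    forall s : {nonneg R}, ((grid t j i)%:num <= s%:num)%R ->
      s%:num%:E < tau A (~` A) n.+1 w -> A (w s)].
Proof.
move=> AA [tn Bn].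
have /tau_attained[u [uE nu eu]] := le_lt_trans tn (ltry _).
have u0 : (0 < u%:num)%R by rewrite -lte_fin (le_lt_trans _ nu)// tau_ge0.
rewrite uE lee_fin in tn.
have Bu : B (w u).
  move: Bn; rewrite /exit_state uE (_ : time_of _ = u)//.
  by apply/val_inj => /=; rewrite ger0_norm.
have [[y [e e0 He] Ay] nAu] := eu.
have [wr _] := path_funP w.
have [d d0 Hd] := wr u.
near=> k; near=> j.
have Aky : A_ k y by near: k; exact: AA.
have je : (t%:num / 2 ^+ j < e)%R by near: j; exact: near_mesh.
have jd : (t%:num / 2 ^+ j < d)%R by near: j; exact: near_mesh.
have exP : exists i, (u%:num <= (grid t j i)%:num)%R.
  by exists (2 ^ j)%N; rewrite grid_max.
(* The step ends at the first grid point at or after the exit [u]; this is not the point 0, because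
   [u] is positive. *)
case: (ex_minnP exP) => -[|i] ui mini.
  by move: ui; rewrite grid_num mulr0 mul0r leNgt u0.
have iu : ((grid t j i)%:num < u%:num)%R.
  by rewrite ltNge; apply/negP => /mini; rewrite ltnn.
have gi := gridS t j i.
have left s : ((grid t j i)%:num <= s%:num)%R -> (s%:num < u%:num)%R -> w s = y.
  move=> is_ su; apply: He; rewrite su andbT; lra.
exists i; split.
- by apply: mini; rewrite grid_max.
- split; first by rewrite left.
  by rewrite Hd// ui andTb; lra.
- by rewrite uE lte_fin.
- by move=> s is_; rewrite uE lte_fin => su; rewrite left.
Unshelve. all: by end_near.
Qed.

(** How fine the mesh must be depends on the exit, so only finitely many exits are matched with
    steps at once. *)
Lemma exit_count_le_crossings A B (A_ : (set (borel S))^nat) t N w :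
  (forall x, A x -> \forall k \near \oo, A_ k x) ->
  \forall k \near \oo, \forall j \near \oo,
    (\sum_(n < N) (w \in exit_event A B t n) <=
     crossings (A_ k) B t j (2 ^ j) w)%N.
Proof.
move=> AA.
have : \forall k \near \oo, forall n : 'I_N, exit_event A B t n w ->
  \forall j \near \oo, exists i, [/\ (i < 2 ^ j)%N,
    step (A_ k) B t j i w, (grid t j i)%:num%:E < tau A (~` A) n.+1 w &
    forall s : {nonneg R}, ((grid t j i)%:num <= s%:num)%R ->
      s%:num%:E < tau A (~` A) n.+1 w -> A (w s)].
  apply: filter_forall => n.
  have [nw|nw] := pselect (exit_event A B t n w).
    by apply: filterS (exit_event_crosses AA nw) => k.
  by near=> k => /nw.
apply: filterS => k Hk.
have : \forall j \near \oo, forall n : 'I_N, exit_event A B t n w ->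
  exists i, [/\ (i < 2 ^ j)%N,
    step (A_ k) B t j i w, (grid t j i)%:num%:E < tau A (~` A) n.+1 w &
    forall s : {nonneg R}, ((grid t j i)%:num <= s%:num)%R ->
      s%:num%:E < tau A (~` A) n.+1 w -> A (w s)].
  apply: filter_forall => n.
  have [nw|nw] := pselect (exit_event A B t n w).
    by apply: filterS (Hk n nw) => j.
  by near=> j => /nw.
apply: filterS => j Hj.
apply: (@leq_count_matching _ _ (fun n => w \in exit_event A B t n)
  (fun i => w \in step (A_ k) B t j i)
  (fun n i => (grid t j i)%:num%:E < tau A (~` A) n.+1 w /\
    forall s : {nonneg R}, ((grid t j i)%:num <= s%:num)%R ->
      s%:num%:E < tau A (~` A) n.+1 w -> A (w s))) => [n nN|].
  rewrite inE => /(Hj (Ordinal nN))[i [iM iw ? ?]].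
  by exists i; split => //; rewrite inE.
(* If exits [n < m] shared a step, the path would stay in [A] from its start until the later exit,
   yet at the earlier exit it is outside [A]. *)
move=> n m i nm; rewrite !inE => -[nt _] [mt _] [ni _] [_ Hm].
have /tau_attained[u [uE _ [_ nAu]]] := le_lt_trans nt (ltry _).
apply: nAu; apply: Hm; first by rewrite -lee_fin -uE; exact: ltW.
rewrite -uE; apply: lt_le_trans (tau_lt _) (tau_mono _ _ _); last by rewrite ltnS; exact: nm.
apply: le_lt_trans (le_lt_trans mt (ltry _)).
exact: tau_mono.
Unshelve. all: by end_near.
Qed.

End crossings.

(** * Measurability *)

Lemma measurable_count d (T : measurableType d) (E : nat -> set T) (n m : nat) :
  (forall k, (k < n)%N -> measurable (E k)) ->
  measurable [set w | (m <= \sum_(i < n) (w \in E i))%N].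
Proof.
elim: n m => [|n IH] m mE.
  case: m => [|m]; first by rewrite (_ : mkset _ = setT)//; apply/seteqP; split.
  by rewrite (_ : mkset _ = set0)//; apply/seteqP; split => // w /=; rewrite big_ord0.
have mEn : measurable (E n) by exact: mE.
have {}IH k := IH k (fun k kn => mE k (ltnW kn)).
rewrite (_ : mkset _ = [set w | (m <= \sum_(i < n) (w \in E i))%N] `|`
  ([set w | (m.-1 <= \sum_(i < n) (w \in E i))%N] `&` E n)).
  by apply: measurableU => //; exact: measurableI.
apply/seteqP; split => w /=; rewrite big_ord_recr /=.
  case: (boolP (w \in E n)) => [|_]; last by rewrite addn0; left.
  rewrite inE => Ew mw; right; split=> //.
  by rewrite -ltnS; case: m mw => // m; rewrite addn1.
move=> [mw|[mw Ew]]; first by rewrite (leq_trans mw)// leq_addr.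
by rewrite mem_set// addn1; case: m mw.
Qed.

Section path_measurability.
Context {R : realType} {S : completeMetricType R}.
Implicit Types (A B : set (borel S)) (w : path_space S) (t s : {nonneg R}).

Lemma measurable_coord s :
  measurable_fun setT (fun w : path_space S => w s : borel S).
Proof.
move=> _ C mC; rewrite setTI; apply: sub_sigma_algebra.
by exists s, C.
Qed.

Lemma natural_filtration_measurable t :
  natural_filtration t `<=` @measurable _ (path_space S).
Proof.
by apply: sub_smallest2r => // E [s [C [_ mC ->]]]; exists s, C.
Qed.

Lemma grid_le t (j k : nat) : (k <= 2 ^ j)%N -> ((grid t j k)%:num <= t%:num)%R.
Proof.
move=> kj; rewrite -[leRHS](grid_max t j) !grid_num.
by rewrite ler_wpM2r ?invr_ge0 ?exprn_ge0// ler_wpM2l// ler_nat.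
Qed.

Lemma natural_filtration_step A B t j k : measurable A -> measurable B ->
  (k < 2 ^ j)%N -> natural_filtration t (step A B t j k).
Proof.
move=> mA mB kj.
(* As a measurable type, the filtration at [t] inherits the closure lemmas for measurable sets. *)
pose F := g_sigma_algebraType
  (@coord_events R S [set s | (s%:num <= t%:num)%R]).
have mC s (C : set (borel S)) : (s%:num <= t%:num)%R -> measurable C ->
    measurable ([set w : path_space S | C (w s)] : set F).
  by move=> st mC; apply: sub_sigma_algebra; exists s, C.
have -> : step A B t j k =
    [set w | A (w (grid t j k))] `&` [set w | B (w (grid t j k.+1))] by [].
have : measurable ([set w : path_space S | A (w (grid t j k))] `&`
  [set w | B (w (grid t j k.+1))] : set F).
  by apply: measurableI; apply: mC => //; apply: grid_le => //; exact: ltnW.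
by [].
Qed.

Lemma measurable_step A B t j k : measurable A -> measurable B ->
  measurable (step A B t j k).
Proof.
move=> mA mB.
have -> : step A B t j k =
    [set w | A (w (grid t j k))] `&` [set w | B (w (grid t j k.+1))] by [].
by apply: measurableI; rewrite -[X in measurable X]setTI; exact: measurable_coord.
Qed.

(** Crossings seen on a grid are genuine exits, and a fine enough grid sees the first [n] of them.
    The right-hand side depends on countably many coordinates up to [t], so that [tau] is a stopping
    time. *)
Lemma tau_le_crossings A t n :
  [set w | tau A (~` A) n w <= t%:num%:E] =
  \bigcup_j [set w | (n <= crossings A (~` A) t j (2 ^ j) w)%N].
Proof.
apply/seteqP; split => w /= => [tn|[j _ nj]]; last first.
  by rewrite -(grid_max t j); apply: le_trans (tau_crossings _ _ _ _ _); exact: tau_mono.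
have AA x : A x -> \forall k \near \oo, (fun=> A) (k : nat) x.
  by move=> Ax; exact: nearW.
have /filter_ex[k /filter_ex[j]] :=
  @exit_count_le_crossings _ _ A (~` A) (fun=> A) t n w AA.
rewrite (eq_bigr (fun=> 1%N)).
  by rewrite sum1_card card_ord; exists j.
move=> i _; rewrite mem_set//.
have tin : tau A (~` A) i.+1 w <= t%:num%:E.
  by apply: le_trans (tau_mono _ _ _) tn.
by split => //; apply: exit_state_notin; rewrite (le_lt_trans tin)// ltry.
Qed.

Lemma natural_filtration_tau A t n : measurable A ->
  natural_filtration t [set w | tau A (~` A) n w <= t%:num%:E].
Proof.
move=> mA; rewrite tau_le_crossings.
pose F := g_sigma_algebraType
  (@coord_events R S [set s | (s%:num <= t%:num)%R]).
suff : measurable (\bigcup_j [set w : F |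
  (n <= crossings A (~` A) t j (2 ^ j) w)%N]) by [].
apply: bigcup_measurable => j _; apply: measurable_count => k kj.
by apply: natural_filtration_step => //; exact: measurableC.
Qed.

Lemma stopping_time_tau A n : measurable A -> stopping_time (tau A (~` A) n).
Proof.
by move=> mA; split => [w|t]; [exact: tau_ge0|exact: natural_filtration_tau].
Qed.

Lemma measurable_tau_le A t n : measurable A ->
  measurable [set w | tau A (~` A) n w <= t%:num%:E].
Proof.
by move=> mA; apply: natural_filtration_measurable; exact: natural_filtration_tau.
Qed.

(** Intersecting with [tau <= s] gives the event [tau <= min s t], known at time [min s t] and so at
    [s]. *)
Lemma stopped_events_tau A t n : measurable A ->
  stopped_events (tau A (~` A) n) [set w | tau A (~` A) n w <= t%:num%:E].
Proof.
move=> mA; split; first exact: measurable_tau_le.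
move=> s; have st0 : (0 <= Num.min s%:num t%:num)%R by rewrite le_min !ge0.
pose st := NngNum st0.
have -> : [set w | tau A (~` A) n w <= t%:num%:E] `&`
    [set w | tau A (~` A) n w <= s%:num%:E] =
    [set w | tau A (~` A) n w <= st%:num%:E].
  have -> : st%:num%:E = Order.min s%:num%:E t%:num%:E by rewrite -EFin_min.
  apply/seteqP; split => w /=; rewrite le_min; first by case=> -> ->.
  by move/andP=> [].
have := @natural_filtration_tau A st n mA; apply: sub_smallest2r => //.
move=> E [u [C [/= us mC ->]]]; exists u, C; split => //=.
by rewrite (le_trans us)// ge_min lexx.
Qed.

Lemma measurable_tau A n : measurable A ->
  measurable_fun setT (tau A (~` A) n).
Proof.
move=> mA; apply: (measurability _ (ErealGenOInfty.measurableE R)) => // _ [_ [r ->] <-].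
rewrite setTI.
have -> : tau A (~` A) n @^-1` `]r%:E, +oo[ =
   ~` [set w | tau A (~` A) n w <= r%:E].
  by apply/seteqP; split => w /=; rewrite ?in_itv /= ?andbT ltNge => /negP.
apply: measurableC; have [r0|r0] := leP 0%R r.
  exact: (@measurable_tau_le A (NngNum r0) n).
rewrite (_ : mkset _ = set0)//; apply/seteqP; split => // w /=.
by rewrite leNgt (lt_le_trans _ (tau_ge0 _ _ _))// lte_fin.
Qed.

(** The random time is approximated from the right by dyadic times, and by right-continuity the path
    eventually takes the same value there. The absolute value only makes [T w] a time. *)
Lemma measurable_at (T : path_space S -> R) : measurable_fun setT T ->
  measurable_fun setT (fun w : path_space S => w (`|T w|%:nng%R) : borel S).
Proof.
move=> mT _ C mC; rewrite setTI.
pose one : {nonneg R} := NngNum ler01.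
pose slot j k := [set w : path_space S | (k%:R <= `|T w| * 2 ^+ j < k.+1%:R)%R].
have mslot j k : measurable (slot j k).
  have mf : measurable_fun setT (fun w => `|T w| * 2 ^+ j)%R.
    by apply: measurable_funM => //; exact: measurableT_comp.
  rewrite (_ : slot j k = (fun w => `|T w| * 2 ^+ j)%R @^-1` `[k%:R, k.+1%:R[).
    by rewrite -[X in measurable X]setTI; exact: mf.
  by apply/seteqP; split => w /=; rewrite in_itv.
(* The right end of the slot containing the random time is less than [e] after it. *)
have slotE w (e : R) j k : slot j k w -> (1 / 2 ^+ j < e)%R ->
    (forall u : {nonneg R}, (`|T w| <= u%:num < `|T w| + e)%R ->
      w u = w (`|T w|%:nng%R)) ->
    w (grid one j k.+1) = w (`|T w|%:nng%R).
  move=> /andP[kT Tk] je; apply.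
  have j0 : (0 < 2 ^+ j :> R)%R by rewrite exprn_gt0.
  have : (k%:R / 2 ^+ j <= `|T w|)%R by rewrite ler_pdivrMr.
  have : (`|T w| <= k.+1%:R / 2 ^+ j)%R by rewrite ler_pdivlMr// ltW.
  rewrite gridS grid_num -natr1 mulrDl !mul1r => h1 h2.
  by move: je h1 h2; rewrite div1r => je h1 h2; apply/andP; split; lra.
(* The preimage says that for all large [j] the state at the right end of the slot is in [C]. *)
rewrite (_ : _ @^-1` _ = \bigcup_J \bigcap_(j in [set j | (J <= j)%N]) \bigcup_k
  (slot j k `&` [set w | C (w (grid one j k.+1))])).
  apply: bigcup_measurable => J _; apply: bigcap_measurable => [|j _]; first by exists J => /=.
  apply: bigcup_measurable => k _; apply: measurableI => //.
  by rewrite -[X in measurable X]setTI; exact: measurable_coord.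
apply/seteqP; split => w /= Cw; have [wr _] := path_funP w;
  have [e e0 He] := wr (`|T w|%:nng%R);
  have [J _ HJ] := near_mesh one e0.
- exists J => // j /= Jj.
  exists (Num.truncn (`|T w| * 2 ^+ j)) => //.
  have sl : slot j (Num.truncn (`|T w| * 2 ^+ j)) w.
    by apply: truncn_itv; rewrite mulr_ge0.
  by split => //=; rewrite (slotE _ e)//; exact: HJ.
- case: Cw => J' _ /(_ (maxn J J')) /=; rewrite leq_maxr => /(_ isT)[k _ [sl]] /=.
  by rewrite (slotE _ e)//; apply: HJ => /=; exact: leq_maxl.
Qed.

(** On generating events this reduces to evaluating the path at the random time [|T w| + s]. *)
Lemma measurable_time_shift (T : path_space S -> R) : measurable_fun setT T ->
  measurable_fun setT (fun w : path_space S =>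
    time_shift (`|T w|%:nng%R) w : path_space S).
Proof.
move=> mT; have H := @measurability _ _ (path_space S) (path_space S) setT
  (fun w : path_space S => time_shift (`|T w|%:nng%R) w : path_space S)
  (@coord_events R S setT) erefl.
apply: H => _ [_ [s [C [_ mC ->]]] <-].
rewrite setTI.
have mT' : measurable_fun setT (fun w => `|T w| + s%:num)%R.
  by apply: measurable_funD => //; exact: measurableT_comp.
have := measurable_at mT' measurableT mC; rewrite setTI.
set X := (X in measurable X -> _); set Y := (Y in _ -> measurable Y).
suff -> : X = Y by [].
apply/funext => w; congr (C (w _)); apply/val_inj => /=.
by rewrite ger0_norm// addr_ge0.
Qed.

End path_measurability.

(** * Integrals along the process *)

Lemma ge0_integral_mrestr d (T : measurableType d) (R : realType)
    (m : {measure set T -> \bar R}) (D : set T) (mD : measurable D)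
    (f : T -> \bar R) : measurable_fun setT f -> (forall x, 0 <= f x) ->
  \int[mrestr m mD]_x f x = \int[m]_(x in D) f x.
Proof.
move=> mf f0.
have mDC : measurable (~` D) by exact: measurableC.
have mfE E : measurable_fun E f by exact: measurable_funTS.
rewrite -(setUv D) ge0_integral_setU//=; last first.
  by apply/disj_setPS; rewrite setICr.
rewrite [X in _ + X](_ : _ = 0) ?adde0; last first.
  by apply: null_set_integral => //; rewrite /= /mrestr setICl.
apply: eq_measure_integral => E mE ED.
by rewrite /= /mrestr setIidl.
Qed.

(** The hypothesis writes [c nu] as the sum of the images under [phi n] of [m] restricted to [D n];
    this is the change of variables for it. It is applied first to exit states, then to the paths
    after the exits. *)
Lemma ge0_integral_image_series d d' (T : measurableType d)
    (U : measurableType d') (R : realType) (m : {measure set T -> \bar R})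
    (nu : {measure set U -> \bar R}) (c : {nonneg R}) (D : (set T)^nat)
    (phi : nat -> T -> U) (f : U -> \bar R) :
  (forall n, measurable (D n)) -> (forall n, measurable_fun setT (phi n)) ->
  (forall B, measurable B ->
    c%:num%:E * nu B = \sum_(n <oo) m (D n `&` phi n @^-1` B)) ->
  measurable_fun setT f -> (forall x, 0 <= f x) ->
  c%:num%:E * \int[nu]_x f x = \sum_(n <oo) \int[m]_(x in D n) f (phi n x).
Proof.
move=> mD mphi nuE mf f0.
(* Given explicitly because inference does not find the proof [mphi n]. *)
pose m_ n : {measure set U -> \bar R} :=
  measure_function_pushforward__canonical__measure_function_Measure
    (mrestr m (mD n)) (mphi n).
rewrite -ge0_integral_mscale//.
rewrite (@eq_measure_integral _ _ _ _ (mseries m_ 0)); last first.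
  move=> B mB _; rewrite /= /mscale /= nuE// /mseries; apply: eq_eseriesr => n _.
  by rewrite /m_ /= /pushforward /mrestr setIC.
rewrite ge0_integral_measure_series//; apply: eq_eseriesr => n _.
rewrite ge0_integral_pushforward// preimage_setT ge0_integral_mrestr//.
  exact: measurableT_comp.
by move=> x; exact: f0.
Qed.

Section markov.
Context {R : realType} {S : completeMetricType R}.
Variables (P : R.-pker (borel S) ~> (path_space S)).
Hypothesis markovP : strong_markov_process P.
Variable pi : probability (borel S) R.
Hypothesis statpi : stationary_distribution P pi.

Lemma law_setT (psi : {measure set (borel S) -> \bar R}) :
  law P psi setT = psi setT.
Proof.
rewrite /law; under eq_integral do rewrite prob_kernel.
by rewrite integral_cst// mul1e.
Qed.

Lemma time_of_num (s : {nonneg R}) : time_of s%:num%:E = s.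
Proof. by apply/val_inj; rewrite /= ger0_norm. Qed.

Lemma integral_coord (s : {nonneg R}) (B : set (borel S)) (f : borel S -> \bar R) :
  measurable B -> measurable_fun setT f -> (forall x, 0 <= f x) ->
  \int[law P pi]_(w in [set w : path_space S | B (w s)]) f (w s) =
  \int[pi]_(x in B) f x.
Proof.
move=> mB mf f0.
rewrite [RHS](eq_measure_integral
  (measure_function_pushforward__canonical__measure_function_Measure
    (law P pi) (measurable_coord s))); last first.
  by move=> C mC _; exact: esym (statpi s mC).
rewrite ge0_integral_pushforward//; first exact: measurable_coord.
exact: measurable_funTS.
Qed.

(** The strong Markov property at the constant time [s], where the state has law [pi] by
    stationarity. *)
Lemma markov_property (s : {nonneg R}) (B : set (borel S)) (G : set (path_space S)) :
  measurable B -> measurable G ->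
  law P pi [set w : path_space S | B (w s) /\ G (time_shift s w)] =
  \int[pi]_(x in B) P x G.
Proof.
move=> mB mG.
have st : @stopping_time R S (fun=> s%:num%:E).
  split=> [w|t]; first by rewrite lee_fin.
  rewrite lee_fin; have [_|_] := leP s%:num%R t%:num.
    rewrite (_ : mkset _ = setT); last by apply/seteqP; split.
    exact: (@measurableT _ (g_sigma_algebraType (coord_events _))).
  rewrite (_ : mkset _ = set0); last by apply/seteqP; split.
  exact: sigma_algebra0.
have := markovP.2 pi _ [set w | B (w s)] G st.
have mE : measurable [set w : path_space S | B (w s)].
  by rewrite -[X in measurable X]setTI; exact: measurable_coord.
rewrite (_ : [set w | [/\ _, _ & _]] =
    [set w : path_space S | B (w s) /\ G (time_shift s w)]); last first.
  by apply/seteqP; split => w /=; rewrite time_of_num; [case|move=> []; split; rewrite ?ltry].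
move=> ->//.
  rewrite (_ : [set w | _ /\ _] = [set w : path_space S | B (w s)]); last first.
    by apply/seteqP; split => w /=; [case|split; rewrite ?ltry].
  rewrite time_of_num (@integral_coord s B (P ^~ G))//.
  exact: measurable_kernel.
split=> // t.
have [st'|st'] := leP s%:num%R t%:num%R.
  rewrite (_ : _ `&` _ = [set w : path_space S | B (w s)]).
    by apply: sub_sigma_algebra; exists s, B.
  by apply/seteqP; split => w /=; rewrite lee_fin; [case|].
rewrite (_ : _ `&` _ = set0); first exact: sigma_algebra0.
by apply/seteqP; split => // w /= []; rewrite lee_fin leNgt st'.
Qed.

Lemma law_shift (s : {nonneg R}) (G : set (path_space S)) : measurable G ->
  law P pi [set w : path_space S | G (time_shift s w)] = law P pi G.
Proof.
move=> mG; rewrite [RHS]/law -(markov_property s measurableT mG).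
by congr (law P pi _); apply/seteqP; split => w //= [].
Qed.

End markov.

(** * The intensity of exits *)

Section limn_einf_facts.
Context {R : realType}.
Implicit Types (u : (\bar R)^nat) (b : \bar R).

Lemma near_ge_limn_einf u b : (\forall n \near \oo, b <= u n) ->
  b <= limn_einf u.
Proof.
move=> [N _ bu]; rewrite limn_einf_lim (cvg_lim _ (@cvg_einfs_sup _ u))//.
rewrite (@le_trans _ _ (einfs u N))//; last by apply: ereal_sup_ubound; exists N.
by apply: le_ereal_inf_tmp => _ [n /= Nn <-]; exact: bu.
Qed.

Lemma limn_einf_le u b : (forall n, u n <= b) -> limn_einf u <= b.
Proof.
move=> ub; rewrite limn_einf_lim (cvg_lim _ (@cvg_einfs_sup _ u))//.
apply: ge_ereal_sup => _ [n _ <-]; apply: le_trans (ub n).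
by apply: ereal_inf_lbound; exists n => /=.
Qed.

Lemma measurable_fun_limn_einf d (T : measurableType d) (f : (T -> \bar R)^nat) :
  (forall n, measurable_fun setT (f n)) ->
  measurable_fun setT (fun x => limn_einf (f ^~ x)).
Proof.
move=> mf; apply: measurableT_comp => //.
apply: (@measurable_fun_limn_esup _ _ _ _ (fun n x => - f n x)) => n.
exact: measurableT_comp.
Qed.

End limn_einf_facts.

Lemma measurable_exit_state {R : realType} {S : completeMetricType R}
    (A : set (borel S)) n : measurable A ->
  measurable_fun setT (@exit_state R S A n).
Proof.
move=> mA; apply: (@measurable_at R S (fine \o tau A (~` A) n)).
by apply: measurableT_comp => //; exact: measurable_tau.
Qed.

Lemma measurable_exit_event {R : realType} {S : completeMetricType R}
    (A B : set (borel S)) (t : {nonneg R}) n : measurable A -> measurable B ->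
  measurable (exit_event A B t n).
Proof.
move=> mA mB.
have -> : exit_event A B t n =
  [set w | tau A (~` A) n.+1 w <= t%:num%:E] `&` exit_state A n.+1 @^-1` B by [].
apply: measurableI; first exact: measurable_tau_le.
rewrite -[X in measurable X]setTI; exact: measurable_exit_state.
Qed.

Section intensity.
Context {R : realType} {S : completeMetricType R}.
Variables (P : R.-pker (borel S) ~> (path_space S)).
Hypothesis markovP : strong_markov_process P.
Variable q : R.-ker (borel S) ~> (borel S).
Hypothesis rateq : transition_rate_kernel P q.
Variable pi : probability (borel S) R.
Hypothesis statpi : stationary_distribution P pi.
Variable t : {nonneg R}.
Hypothesis t_gt0 : (0 < t%:num)%R.

Let grid_event (B : set (borel S)) j : set (path_space S) :=
  [set w | B (w (grid t j 1))].

(** The transition probability over one mesh times the number of steps in [[0, t]]; for [x] outside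
    [B] it tends to [t q x B]. *)
Let rate j B x : \bar R := (2 ^+ j)%:E * P x (grid_event B j).

Let measurable_grid_event B j : measurable B -> measurable (grid_event B j).
Proof. by move=> mB; rewrite -[X in measurable X]setTI; exact: measurable_coord. Qed.

Let measurable_rate j B : measurable B -> measurable_fun setT (rate j B).
Proof.
move=> mB; apply: emeasurable_funM => //.
by apply: measurable_kernel; exact: measurable_grid_event.
Qed.

Let rate_ge0 j B x : 0 <= rate j B x.
Proof. by rewrite mule_ge0// lee_fin exprn_ge0. Qed.

Let P_fin x (G : set (path_space S)) : measurable G -> P x G \is a fin_num.
Proof.
move=> mG; rewrite ge0_fin_numE// (@le_lt_trans _ _ (P x setT))//.
  by apply: le_measure; rewrite ?inE.
by rewrite prob_kernel ltry.
Qed.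

(** An infinite rate would contradict the finite error bound at [h = d / 2]. *)
Lemma rate_kernel_fin x B : measurable B -> ~ B x -> q x B \is a fin_num.
Proof.
move=> mB nBx; have [C [d [d0 /(_ (NngNum (ltW (divr_gt0 d0 (@ltr0Sn R 1)))))]]] := rateq mB nBx.
rewrite /= divr_gt0//= ltr_pdivrMr// ltr_pMr// ltr1n => /(_ isT).
have mE (h : {nonneg R}) : measurable [set w : path_space S | B (w h)].
  by rewrite -[X in measurable X]setTI; exact: measurable_coord.
rewrite -(fineK (P_fin x (mE _))) ge0_fin_numE//.
case: (q x B) => [r| |]//.
- by rewrite ltry.
- by rewrite gt0_muley ?lte_fin ?divr_gt0.
Qed.

(** With mesh [m = t / 2 ^ j], an error of [C m ^ 2] per step, multiplied by [2 ^ j], is at most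
    [m |C| t], which tends to 0. *)
Let rate_cvg x B : measurable B -> ~ B x ->
  rate ^~ B ^~ x @ \oo --> t%:num%:E * q x B.
Proof.
move=> mB nBx; have [C [d [d0 H]]] := rateq mB nBx.
pose p j := fine (P x (grid_event B j)).
have pE j : P x (grid_event B j) = (p j)%:E.
  by rewrite fineK//; apply: P_fin; exact: measurable_grid_event.
have qE := fineK (rate_kernel_fin mB nBx).
rewrite -qE -EFinM /rate.
under eq_fun do rewrite pE -EFinM.
apply: cvg_EFin; first exact: nearW.
set r := fine (q x B).
apply/cvgrPdist_le => /= e e0.
(* The summand 1 keeps the later divisor positive when [C] is 0. *)
have C0 : (0 < `|C| * t%:num + 1)%R by rewrite ltr_wpDl ?mulr_ge0.
near=> j.
have jd : (t%:num / 2 ^+ j < d)%R by near: j; exact: near_mesh.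
have je : (t%:num / 2 ^+ j < e / (`|C| * t%:num + 1))%R.
  by near: j; apply: near_mesh; rewrite divr_gt0.
have j0 : (0 < 2 ^+ j :> R)%R by rewrite exprn_gt0.
set m := (t%:num / 2 ^+ j)%R in jd je.
have gE : (grid t j 1)%:num = m by rewrite grid_num mulr1.
have m0 : (0 < m)%R by rewrite divr_gt0.
have tE : t%:num = (2 ^+ j * m)%R by rewrite /m mulrCA divff ?mulr1// gt_eqF.
have := H (grid t j 1); rewrite gE m0 jd => /(_ isT).
rewrite -/(grid_event B j) pE -qE -/r -EFinM -EFinB abse_EFin lee_fin => Hm.
rewrite tE distrC -mulrA -mulrBr normrM gtr0_norm//.
rewrite (@le_trans _ _ (2 ^+ j * (`|C| * m ^+ 2))%R)//.
  rewrite ler_wpM2l ?(ltW j0)// (le_trans Hm)// ler_wpM2r ?sqr_ge0// ler_norm//.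
rewrite (_ : 2 ^+ j * (`|C| * m ^+ 2) = m * (`|C| * t%:num))%R; last first.
  rewrite tE; ring.
move: je; rewrite ltr_pdivlMr// => je.
rewrite (le_trans _ (ltW je))// ler_wpM2l ?(ltW m0)// lerDl.
Unshelve. all: by end_near.
Qed.

Let law_step A B j i : measurable A -> measurable B ->
  law P pi (step A B t j i) = \int[pi]_(x in A) P x (grid_event B j).
Proof.
move=> mA mB.
rewrite -(markov_property markovP statpi (grid t j i) mA (measurable_grid_event j mB)).
have gE : grid t j i.+1 = ((grid t j i)%:num + (grid t j 1)%:num)%:nng%R.
  by apply/val_inj; rewrite /= -natr1 mulrDr mulrDl.
by rewrite /step gE.
Qed.

Let crossingsE A B j n (w : path_space S) :
  (crossings A B t j n w)%:R%:E = \sum_(i < n) (\1_(step A B t j i) w)%:E :> \bar R.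
Proof. by rewrite /crossings natr_sum sumEFin. Qed.

Let integral_crossings A B j : measurable A -> measurable B ->
  \int[law P pi]_w (crossings A B t j (2 ^ j) w)%:R%:E =
  \int[pi]_(x in A) rate j B x.
Proof.
move=> mA mB.
under eq_integral do rewrite crossingsE.
rewrite ge0_integral_sum//; last first.
  move=> i; apply/measurable_EFinP/measurable_indic; exact: measurable_step.
have stepE (i : 'I_(2 ^ j)) : \int[law P pi]_w (\1_(step A B t j i) w)%:E =
    \int[pi]_(x in A) P x (grid_event B j).
  by rewrite integral_indic ?setIT; [exact: law_step| |exact: measurable_step].
rewrite (eq_bigr _ (fun i _ => stepE i)).
rewrite sumr_const card_ord.
transitivity ((2 ^ j)%:R%:E * \int[pi]_(x in A) P x (grid_event B j)).
  by rewrite mule_natl.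
rewrite natrX /rate ge0_integralZl//.
apply: measurable_funTS; apply: measurable_kernel; exact: measurable_grid_event.
Qed.

(** Needed to integrate the counts and to apply Fatou's lemma to them. *)
Let measurable_crossings A B j : measurable A -> measurable B ->
  measurable_fun setT
    (fun w : path_space S => (crossings A B t j (2 ^ j) w)%:R%:E : \bar R).
Proof.
move=> mA mB; under eq_fun do rewrite crossingsE.
apply: emeasurable_sum => i.
by apply/measurable_EFinP/measurable_indic; exact: measurable_step.
Qed.

Let measurable_rate_kernel B : measurable B ->
  measurable_fun setT (fun x => t%:num%:E * q x B).
Proof.
by move=> mB; apply: emeasurable_funM => //; exact: measurable_kernel.
Qed.

Let exit_count_integral A B N : measurable A -> measurable B ->
  \int[law P pi]_w (\sum_(n < N) (w \in exit_event A B t n))%:R%:E =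
  \sum_(n < N) law P pi (exit_event A B t n).
Proof.
move=> mA mB; have mF n := measurable_exit_event t n mA mB.
under eq_integral do rewrite natr_sum -sumEFin.
rewrite ge0_integral_sum//; last first.
  by move=> n; apply/measurable_EFinP/measurable_indic.
by apply: eq_bigr => n _; rewrite integral_indic ?setIT.
Qed.

(* The constants of the O(h^2) terms depend on the starting point, so the rates
   may fail to be dominated on A; on these sets, which exhaust A, they are
   bounded uniformly in the mesh. *)
Let slow A (k : nat) : set (borel S) :=
  A `&` [set x | forall j, rate j (~` A) x <= k%:R%:E].

Let measurable_slow A k : measurable A -> measurable (slow A k).
Proof.
move=> mA; apply: measurableI => //.
rewrite (_ : mkset _ = \bigcap_j [set x | rate j (~` A) x <= k%:R%:E]).
  apply: bigcap_measurable => [|j _]; first by exists 0%N.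
  rewrite -[X in measurable X]setTI; apply: emeasurable_fun_infty_c => //.
  by apply: measurable_rate; exact: measurableC.
by apply/seteqP; split => x /= H j => [_|]; exact: H.
Qed.

(** At a fixed point of [A] the rates converge to a finite limit, so they are bounded in [j]. *)
Let slow_exhaust A x : measurable A -> A x -> \forall k \near \oo, slow A k x.
Proof.
move=> mA Ax; have mAC : measurable (~` A) by exact: measurableC.
have nAx : ~ (~` A) x by [].
have cv := rate_cvg mAC nAx.
have rE j : rate j (~` A) x = (fine (rate j (~` A) x))%:E.
  by rewrite fineK// fin_numM// P_fin//; exact: measurable_grid_event.
have : cvgn (fun j => fine (rate j (~` A) x)).
  apply/cvg_ex; exists (fine (t%:num%:E * q x (~` A))).
  apply: fine_cvg; rewrite fineK//.
  by rewrite fin_numM//; exact: rate_kernel_fin.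
move=> /cvg_has_ub[M MP].
near=> k; split=> // j.
rewrite rE lee_fin (@le_trans _ _ M)//.
  by rewrite (le_trans (ler_norm _))//; apply: MP; exists j.
by near: k; exact: nbhs_infty_ger.
Unshelve. all: by end_near.
Qed.

(** Dominated convergence with the constant [k]: as [B] lies in the complement of [A], its rates are
    at most those of the complement, which [k] bounds on [slow A k]. *)
Let rate_integral_cvg A B k : measurable A -> measurable B -> B `<=` ~` A ->
  \int[pi]_(x in slow A k) rate j B x @[j --> \oo] -->
  \int[pi]_(x in slow A k) (t%:num%:E * q x B).
Proof.
move=> mA mB BA.
apply: (@dominated_cvg _ _ _ pi _ (measurable_slow k mA) _ _ (cst k%:R%:E)) => //.
- by move=> j; apply: measurable_funTS; exact: measurable_rate.
- by move=> x [Ax _]; apply: rate_cvg => // /BA.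
- exact: (finite_measure_integrable_cst pi k%:R (measurable_slow k mA)).
- move=> j x [Ax kx]; rewrite gee0_abs//; apply: le_trans (kx j).
  rewrite lee_wpmul2l// ?lee_fin ?exprn_ge0//.
  apply: le_measure; rewrite ?inE; try exact: measurable_grid_event.
    by apply: measurable_grid_event; exact: measurableC.
  by move=> w /BA.
Qed.

(* Fatou's lemma along both limits, in the mesh and in the truncation, avoids
   dominating the number of exits, not yet known to have a finite mean. *)
Lemma exit_count_upper A B N : measurable A -> measurable B -> B `<=` ~` A ->
  \sum_(n < N) law P pi (exit_event A B t n) <=
  t%:num%:E * \int[pi]_(x in A) q x B.
Proof.
move=> mA mB BA.
rewrite -exit_count_integral//.
pose D k j (w : path_space S) : \bar R :=
  (crossings (slow A k) B t j (2 ^ j) w)%:R%:E.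
have mD k j : measurable_fun setT (D k j).
  by apply: measurable_crossings => //; exact: measurable_slow.
pose L k w := limn_einf (fun j => D k j w).
have mL k : measurable_fun setT (L k) by exact: measurable_fun_limn_einf.
have L0 k w : 0 <= L k w.
  by apply: near_ge_limn_einf; apply: nearW => j; rewrite lee_fin.
have step1 : \int[law P pi]_w
    (\sum_(n < N) (w \in exit_event A B t n))%:R%:E <=
    \int[law P pi]_w limn_einf (fun k => L k w).
  apply: ge0_le_integral => //.
  - under eq_fun do rewrite natr_sum -sumEFin.
    apply: emeasurable_sum => n; apply/measurable_EFinP/measurable_indic.
    exact: measurable_exit_event.
  - exact: measurable_fun_limn_einf.
  - move=> w _; apply: near_ge_limn_einf.
    have := @exit_count_le_crossings _ _ A B (slow A) t N w
      (fun x => slow_exhaust mA).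
    apply: filterS => k Hk; apply: near_ge_limn_einf.
    by apply: filterS Hk => j; rewrite lee_fin ler_nat.
apply: (le_trans step1); apply: (le_trans (fatou _ _ _ _)) => //.
apply: limn_einf_le => k.
apply: (le_trans (fatou _ _ _ _)) => //; first by move=> j w _; rewrite lee_fin.
rewrite (_ : (fun j => _) = (fun j => \int[pi]_(x in slow A k) rate j B x)).
  2: by apply/funext => j; exact: integral_crossings (measurable_slow k mA) mB.
rewrite (cvg_limn_einf_sup (@rate_integral_cvg A B k mA mB BA)).
rewrite -ge0_integralZl//.
  apply: ge0_subset_integral => //.
  - exact: measurable_slow.
  - by apply: measurable_funTS; exact: measurable_rate_kernel.
  - by move=> x [].
by apply: measurable_funTS; exact: measurable_kernel.
Qed.

(** Fatou's lemma bounds the integral of the limit rate by the mean numbers of crossings, and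
    crossings on a grid never outnumber exits. *)
Lemma exit_count_lower A : measurable A ->
  t%:num%:E * \int[pi]_(x in A) q x (~` A) <=
  \sum_(n <oo) law P pi (exit_event A (~` A) t n).
Proof.
move=> mA; have mAC : measurable (~` A) by exact: measurableC.
rewrite -ge0_integralZl//; last first.
  by apply: measurable_funTS; exact: measurable_kernel.
have -> : \int[pi]_(x in A) (t%:num%:E * q x (~` A)) =
    \int[pi]_(x in A) limn_einf (fun j => rate j (~` A) x).
  apply: eq_integral => x; rewrite inE => Ax.
  have nAx : ~ (~` A) x by [].
  by rewrite (cvg_limn_einf_sup (rate_cvg mAC nAx)).
apply: (le_trans (fatou _ _ _ _)) => //.
  by move=> j; apply: measurable_funTS; exact: measurable_rate.
apply: limn_einf_le => j; rewrite -integral_crossings//.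
apply: (@le_trans _ _ (\sum_(n < 2 ^ j) law P pi (exit_event A (~` A) t n))).
  rewrite -exit_count_integral//; apply: ge0_le_integral => //.
  - exact: measurable_crossings.
  - under eq_fun do rewrite natr_sum -sumEFin.
    apply: emeasurable_sum => n; apply/measurable_EFinP/measurable_indic.
    exact: measurable_exit_event.
  - move=> w _; rewrite lee_fin ler_nat.
    set c := crossings _ _ _ _ _ _.
    have cj : (c <= 2 ^ j)%N.
      rewrite /c /crossings -[leqRHS]card_ord -sum1_card.
      by apply: leq_sum => i _; case: (_ \in _).
    (* With [c] crossings, the exits number 1 to [c] all occur by time [t], so at least [c] terms of
       the sum are 1. *)
    have ct : tau A (~` A) c w <= t%:num%:E.
      by rewrite -(grid_max t j); exact: tau_crossings.
    rewrite -[leqLHS]card_ord -sum1_card (big_ord_widen _ (fun=> 1%N) cj).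
    rewrite big_mkcond; apply: leq_sum => i _; case: ifPn => // ic.
    have it : tau A (~` A) i.+1 w <= t%:num%:E.
      by apply: le_trans ct; exact: tau_mono.
    rewrite mem_set//; split=> //; apply: exit_state_notin.
    by rewrite (le_lt_trans it)// ltry.
rewrite -(big_mkord xpredT (fun n => law P pi (exit_event A (~` A) t n))).
exact: nneseries_lim_ge.
Qed.

End intensity.

(** * The Palm measure of the exits *)

Section palm.
Context {R : realType} {S : completeMetricType R}.
Variables (P : R.-pker (borel S) ~> (path_space S)).
Hypothesis markovP : strong_markov_process P.
Variable q : R.-ker (borel S) ~> (borel S).
Hypothesis rateq : transition_rate_kernel P q.
Variable pi : probability (borel S) R.
Hypothesis statpi : stationary_distribution P pi.
Variables (A : set (borel S)) (mA : measurable A).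
Hypothesis rate_gt0 : 0 < exit_rate q pi A.
Hypothesis rate_fin : exit_rate q pi A < +oo.

Local Notation r := (exit_rate q pi A).
Local Notation mu := (exit_distribution q pi mA).

Let mAC : measurable (~` A). Proof. exact: measurableC. Qed.

Lemma exit_rate_fin_num : r \is a fin_num.
Proof. by rewrite ge0_fin_numE// ltW. Qed.

Lemma stationary_rate_le B : measurable B ->
  stationary_rate q pi A (B `&` ~` A) <= r.
Proof.
move=> mB; apply: ge0_le_integral => //.
- by apply: measurable_funTS; apply: measurable_kernel; exact: measurableI.
- by apply: measurable_funTS; exact: measurable_kernel.
- by move=> x _; apply: le_measure; rewrite ?inE//; exact: measurableI.
Qed.

Lemma stationary_rate_fin_num B : measurable B ->
  stationary_rate q pi A (B `&` ~` A) \is a fin_num.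
Proof.
move=> mB; rewrite ge0_fin_numE ?integral_ge0//.
by rewrite (le_lt_trans (stationary_rate_le mB)).
Qed.

Lemma exit_distribution_rate B : measurable B ->
  r * mu B = stationary_rate q pi A (B `&` ~` A).
Proof.
move=> mB; rewrite /exit_distribution muleC -(fineK exit_rate_fin_num).
have r0 : fine r != 0%R by rewrite gt_eqF// fine_gt0// rate_gt0 rate_fin.
rewrite -(fineK (stationary_rate_fin_num mB)) inver (negbTE r0) -!EFinM.
by rewrite divfK.
Qed.

Lemma exit_distribution_le1 B : measurable B -> mu B <= 1.
Proof.
move=> mB; rewrite -(@exit_distribution_setT _ _ q pi A mA) ?rate_gt0//.
by apply: le_measure; rewrite ?inE.
Qed.

(** The upper bound holds for [B] and for its complement, and the two bounds add up to the lower
    bound for all exits; as the total is finite, both are equalities. *)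
Lemma exit_count (t : {nonneg R}) B : (0 < t%:num)%R -> measurable B ->
  \sum_(n <oo) law P pi (exit_event A B t n) = t%:num%:E * (r * mu B).
Proof.
move=> t0 mB; rewrite exit_distribution_rate//.
pose sr C := stationary_rate q pi A (C `&` ~` A).
pose a C := \sum_(n <oo) law P pi (exit_event A (C `&` ~` A) t n).
(* Exit states are outside [A], so only the part of [B] outside [A] matters. *)
have -> : \sum_(n <oo) law P pi (exit_event A B t n) = a B.
  apply: eq_eseriesr => n _; congr (law P pi _).
  apply/seteqP; split => w [wt] => [Bw|[]//]; split=> //; split=> //.
  by apply: exit_state_notin; rewrite (le_lt_trans wt)// ltry.
have mI C : measurable C -> measurable (C `&` ~` A) by move=> ?; exact: measurableI.
have upper C : measurable C -> a C <= t%:num%:E * sr C.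
  move=> mC; apply: lime_le; first by apply: is_cvg_nneseries.
  apply: nearW => N; rewrite big_mkord.
  by apply: (exit_count_upper markovP rateq statpi t0 N mA (mI _ mC)) => x [].
have mBC : measurable (~` B) by exact: measurableC.
have aD : \sum_(n <oo) law P pi (exit_event A (~` A) t n) = a B + a (~` B).
  rewrite /a -nneseriesD//; apply: eq_eseriesr => n _.
  have mEB := measurable_exit_event t n mA (mI _ mB).
  have mEBC := measurable_exit_event t n mA (mI _ mBC).
  rewrite -measureU//; last first.
    by apply/seteqP; split => // w [[_ [Bw _]] [_ [nBw _]]].
  congr (law P pi _); apply/seteqP; split => w.
    move=> [wt Aw]; have [Bw|Bw] := pselect (B (exit_state A n.+1 w)).
      by left.
    by right.
  by case=> -[wt [_ Aw]].
have rD : r = sr B + sr (~` B).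
  rewrite /sr /stationary_rate -ge0_integralD//; last 2 first.
  - by apply: measurable_funTS; apply: measurable_kernel; exact: mI.
  - by apply: measurable_funTS; apply: measurable_kernel; exact: mI.
  apply: eq_integral => x _; rewrite -measureU//; try exact: mI.
    by rewrite -setIUl setUv setTI.
  by rewrite setIACA setICr set0I.
apply/eqP; rewrite eq_le upper//=.
have := exit_count_lower markovP rateq statpi t0 mA.
rewrite aD -/(stationary_rate q pi A (~` A)) -/(exit_rate q pi A) rD.
have fB := stationary_rate_fin_num mB; have fBC := stationary_rate_fin_num mBC.
rewrite muleDr ?fin_num_adde_defl// => h.
have := le_trans h (leeD2l (a B) (upper _ mBC)).
by rewrite leeD2rE// fin_numM.
Qed.

Definition palm_event (t : {nonneg R}) (G : set (path_space S)) n :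
    set (path_space S) :=
  [set w | tau A (~` A) n.+1 w <= t%:num%:E /\
           G (time_shift (time_of (tau A (~` A) n.+1 w)) w)].

(** The factor [t r] as a nonnegative real, as needed to scale a measure. *)
Let c (t : {nonneg R}) : {nonneg R} := (t%:num * `|fine r|)%:nng%R.

Let cE (t : {nonneg R}) x : (c t)%:num%:E * x = t%:num%:E * (r * x).
Proof.
by rewrite muleA; congr (_ * _); rewrite /= EFinM ger0_norm ?fine_ge0 ?fineK ?exit_rate_fin_num ?ltW.
Qed.

Lemma measurable_shift_tau n : measurable_fun setT (fun w : path_space S =>
  time_shift (time_of (tau A (~` A) n w)) w : path_space S).
Proof.
apply: (@measurable_time_shift R S (fine \o tau A (~` A) n)).
by apply: measurableT_comp => //; exact: measurable_tau.
Qed.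

Lemma measurable_palm_event (t : {nonneg R}) G n : measurable G ->
  measurable (palm_event t G n).
Proof.
move=> mG; apply: (@measurableI _ _
  [set w | tau A (~` A) n.+1 w <= t%:num%:E]
  ((fun w => time_shift (time_of (tau A (~` A) n.+1 w)) w) @^-1` G)).
  exact: measurable_tau_le.
by rewrite -[X in measurable X]setTI; exact: measurable_shift_tau.
Qed.

(** By [exit_count], [t r mu] is the sum of the laws of the exit states on [tau <= t]. Integrating
    [P x G] against it, the strong Markov property at each exit turns [P x G] at the exit state into
    the event that the future is in [G]. *)
Lemma palm (t : {nonneg R}) G : (0 < t%:num)%R -> measurable G ->
  t%:num%:E * (r * law P mu G) = \sum_(n <oo) law P pi (palm_event t G n).
Proof.
move=> t0 mG; rewrite -cE /law.
rewrite (@ge0_integral_image_series _ _ _ _ _ (law P pi) mu (c t)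
  (fun n => [set w | tau A (~` A) n.+1 w <= t%:num%:E])
  (fun n => exit_state A n.+1) (P ^~ G))//; last 4 first.
- by move=> n; exact: measurable_tau_le.
- by move=> n; exact: measurable_exit_state.
- by move=> B mB; rewrite cE -exit_count.
- exact: measurable_kernel.
apply: eq_eseriesr => n _.
have := markovP.2 pi _ _ G (stopping_time_tau n.+1 mA) (stopped_events_tau t n.+1 mA) mG.
have fin w : tau A (~` A) n.+1 w <= t%:num%:E -> tau A (~` A) n.+1 w < +oo.
  by move=> h; rewrite (le_lt_trans h)// ltry.
rewrite (_ : [set w | _ /\ _] = [set w | tau A (~` A) n.+1 w <= t%:num%:E]); last first.
  by apply/seteqP; split => w /=; [case|move=> h; split => //; exact: fin].
rewrite /exit_state => <-; congr (law P pi _).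
by apply/seteqP; split => w /= [h]; [move=> _|move=> ?; split => //; exact: fin].
Qed.

Lemma palm_integral (t : {nonneg R}) (g : path_space S -> \bar R) : (0 < t%:num)%R ->
  measurable_fun setT g -> (forall w, 0 <= g w) ->
  t%:num%:E * (r * \int[law P mu]_w g w) =
  \sum_(n <oo) \int[law P pi]_(w in [set w | tau A (~` A) n.+1 w <= t%:num%:E])
    g (time_shift (time_of (tau A (~` A) n.+1 w)) w).
Proof.
move=> t0 mg g0; rewrite -cE.
rewrite (@ge0_integral_image_series _ _ _ _ _ (law P pi) (law P mu) (c t)
  (fun n => [set w | tau A (~` A) n.+1 w <= t%:num%:E])
  (fun n w => time_shift (time_of (tau A (~` A) n.+1 w)) w))//.
- by move=> n; exact: measurable_tau_le.
- by move=> n; exact: measurable_shift_tau.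
- by move=> G mG; rewrite cE palm.
Qed.

End palm.

(** * Stationarity *)

(** This is division by [t] as [t] tends to infinity: if [b < a], then [t = (|k| + 1) / (a - b)]
    would give [|k| + 1 <= k]. *)
Lemma le_of_linear_bound (R : realFieldType) (a b k : R) :
  (forall t, 0 < t -> t * a <= k + t * b)%R -> (a <= b)%R.
Proof.
move=> H; rewrite leNgt; apply/negP => ba.
have ab0 : (0 < a - b)%R by rewrite subr_gt0.
have t0 : (0 < (`|k| + 1) / (a - b))%R by rewrite divr_gt0// ltr_wpDl.
have := H _ t0; rewrite -lerBlDr -mulrBr divfK ?gt_eqF//.
by rewrite leNgt (le_lt_trans (ler_norm k))// ltrDl.
Qed.

Section stationarity.
Context {R : realType} {S : completeMetricType R}.
Variables (P : R.-pker (borel S) ~> (path_space S)).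
Hypothesis markovP : strong_markov_process P.
Variable q : R.-ker (borel S) ~> (borel S).
Hypothesis rateq : transition_rate_kernel P q.
Variable pi : probability (borel S) R.
Hypothesis statpi : stationary_distribution P pi.
Variables (A : set (borel S)) (mA : measurable A).
Hypothesis rate_gt0 : 0 < exit_rate q pi A.
Hypothesis rate_fin : exit_rate q pi A < +oo.

Local Notation rate := (exit_rate q pi A).
Local Notation mu := (exit_distribution q pi mA).
Local Notation r := (fine rate).

Let r_gt0 : (0 < r)%R.
Proof. by rewrite fine_gt0// rate_gt0. Qed.

Let rateE : rate = r%:E.
Proof. by rewrite fineK// ge0_fin_numE// ltW. Qed.

Lemma law_le1 (psi : {measure set (borel S) -> \bar R}) G : measurable G ->
  psi setT = 1 -> law P psi G <= 1.
Proof.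
by move=> mG <-; rewrite -(law_setT P psi); apply: le_measure; rewrite ?inE.
Qed.

Lemma exit_distributionT : mu setT = 1.
Proof. by apply: exit_distribution_setT; rewrite rate_gt0. Qed.

Lemma measurable_finite_exit n B : measurable B ->
  measurable [set w | tau A (~` A) n w < +oo /\ B (exit_state A n w)].
Proof.
move=> mB; apply: (@measurableI _ _ [set w | tau A (~` A) n w < +oo]
  (exit_state A n @^-1` B)); rewrite -[X in measurable X]setTI.
  by apply: emeasurable_fun_infty_o => //; exact: measurable_tau.
exact: measurable_exit_state.
Qed.

Lemma fin_num_law_mu G : measurable G -> law P mu G \is a fin_num.
Proof.
move=> mG; rewrite ge0_fin_numE// (le_lt_trans (law_le1 mG exit_distributionT))//.
exact: ltry.
Qed.

(* The exits counted by the two sides before time t differ by at most n, which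
   is negligible as t tends to infinity. *)
Lemma exit_distribution_le_exits n B : measurable B ->
  mu B <= law P mu [set w | tau A (~` A) n w < +oo /\ B (exit_state A n w)].
Proof.
move=> mB; set G := (X in law _ _ X).
have mG : measurable G by exact: measurable_finite_exit.
have fG := fin_num_law_mu mG.
have fB : mu B \is a fin_num.
  rewrite ge0_fin_numE// (le_lt_trans _ (ltry 1%R))//.
  exact: (exit_distribution_le1 mA rate_gt0 rate_fin).
rewrite -(fineK fG) -(fineK fB) lee_fin -(ler_pM2l r_gt0).
apply: (@le_of_linear_bound _ _ _ n%:R) => t t0.
pose t' : {nonneg R} := NngNum (ltW t0).
have := exit_count markovP rateq statpi mA rate_gt0 rate_fin t0 mB (t := t').
rewrite -lee_fin EFinD !EFinM (fineK fB) (fineK fG) -rateE.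
move=> <-; rewrite (palm markovP rateq statpi mA rate_gt0 rate_fin _ mG (t := t'))//.
(* The first [n] exits contribute at most [n]; exit number [i.+1 + n] is the [n]-th exit seen from
   exit [i.+1], which also occurs by time [t]. *)
rewrite (nneseries_split 0 n)// add0n; apply: leeD.
  rewrite big_mkord (@le_trans _ _ (\sum_(i < n) 1))//.
    apply: lee_sum => i _; apply: law_le1; last exact: probability_setT.
    exact: measurable_exit_event.
  by rewrite sumEFin sumr_const card_ord.
rewrite -nneseries_addn//; apply: lee_nneseries => // i _.
apply: le_measure; rewrite ?inE.
- exact: measurable_exit_event.
- exact: measurable_palm_event.
move=> w [wt Bw].
have tin : tau A (~` A) (i.+1 + n) w < +oo.
  by rewrite addSn (le_lt_trans wt)// ltry.
have ti : tau A (~` A) i.+1 w < +oo.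
  by rewrite (le_lt_trans (tau_mono _ _ _) tin)// leq_addr.
have tE := tau_num ti.
split.
  by apply: le_trans wt; apply: tau_mono; rewrite ltnS leq_addr.
split; last by rewrite -(exit_state_shift tE).
move: tin; rewrite (tau_shift n tE) !ltey; apply: contraNN => /eqP ->.
by rewrite addeC.
Qed.

(* A one-sided bound for B and for its complement suffices, as mu is a
   probability. *)
Lemma stationary_exits : stationary_for_exits P A mu.
Proof.
move=> n B _ mB; apply/eqP; rewrite eq_le exit_distribution_le_exits// andbT.
have mBC : measurable (~` B) by exact: measurableC.
have mG C := @measurable_finite_exit n C.
set G := (X in law _ _ X); set G' := [set w | tau A (~` A) n w < +oo /\
  (~` B) (exit_state A n w)].
have fin1 : mu (~` B) \is a fin_num.
  rewrite ge0_fin_numE// (le_lt_trans _ (ltry 1%R))//.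
  exact: (exit_distribution_le1 mA rate_gt0 rate_fin).
have GG : law P mu G + law P mu G' <= 1.
  rewrite -measureU//; [|exact: mG|exact: mG|].
  - apply: law_le1 => //; last exact: exit_distributionT.
    by apply: measurableU; exact: mG.
  - by apply/seteqP; split => // w [[_ Bw] [_ nBw]].
have muD : mu (B `|` ~` B) = mu B + mu (~` B).
  by apply: measureU => //; rewrite setICr.
rewrite -(leeD2rE _ _ fin1) -muD.
rewrite setUv exit_distributionT; apply: le_trans GG; apply: leeD2l.
exact: exit_distribution_le_exits.
Qed.

End stationarity.

(** * The mean exit time *)

Section recurrence.
Context {R : realType} {S : completeMetricType R}.
Implicit Types (A : set (borel S)) (w : path_space S) (s t : {nonneg R}).

(** In this form the event is visibly decreasing in [s], and easy to follow under time shifts. *)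
Lemma exit_time_after A w s :
  tau A (~` A) 1 (time_shift s w) < +oo <->
  exists2 u : {nonneg R}, (s%:num < u%:num)%R & exit_time A w u.
Proof.
split=> [/tau_attained[t [_]]|[u su eu]].
  rewrite tau0 lte_fin => t0 /(exit_time_shift _ _ _ t0) et.
  by exists (s%:num + t%:num)%:nng%R => //=; rewrite ltrDl.
have us0 : (0 < u%:num - s%:num)%R by rewrite subr_gt0.
pose t := NngNum (ltW us0).
rewrite (@le_lt_trans _ _ t%:num%:E) ?ltry//; apply: tau_le; first by rewrite tau0 lte_fin.
apply/exit_time_shift => //.
by rewrite (_ : _%:nng%R = u)//; apply/val_inj; rewrite /= subrKC.
Qed.

Variables (P : R.-pker (borel S) ~> (path_space S)).
Hypothesis markovP : strong_markov_process P.
Variable pi : probability (borel S) R.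
Hypothesis statpi : stationary_distribution P pi.
Variables (A : set (borel S)) (mA : measurable A).
Variable t0 : {nonneg R}.
Hypothesis t0_gt0 : (0 < t0%:num)%R.
Hypothesis erg : ergodic (law P pi) (time_shift t0).

Lemma measurable_tau_fin n : measurable [set w | tau A (~` A) n w < +oo].
Proof.
rewrite -[X in measurable X]setTI.
by apply: emeasurable_fun_infty_o => //; exact: measurable_tau.
Qed.

(** The events [F j] of an exit after time [j t0] decrease and are equally likely by stationarity,
    so their intersection has the probability of an exit. Unlike a single [F j], the intersection is
    exactly invariant under the shift, so ergodicity applies. *)
Lemma exit_almost_surely :
  law P pi [set w | tau A (~` A) 1 w < +oo] != 0 ->
  law P pi [set w | tau A (~` A) 1 w < +oo] = 1.
Proof.
pose T j : {nonneg R} := NngNum (mulr_ge0 (ler0n R j) (ltW t0_gt0)).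
pose F j : set (path_space S) := [set w | tau A (~` A) 1 (time_shift (T j) w) < +oo].
have mtau := measurable_tau_fin 1.
have mF j : measurable (F j).
  have mc : measurable_fun setT (cst (T j)%:num : path_space S -> R) by [].
  have := measurable_time_shift mc measurableT mtau; rewrite setTI.
  congr measurable; apply/seteqP; split => w; rewrite /F /=;
    rewrite (_ : `|(T j)%:num|%:nng%R = T j) //;
    by apply/val_inj; rewrite /= ger0_norm.
have lawF j : law P pi (F j) = law P pi [set w | tau A (~` A) 1 w < +oo].
  exact: (law_shift markovP statpi (T j) mtau).
have Fdecr : nonincreasing_seq F.
  move=> i j ij; apply/subsetPset => w /exit_time_after[u ju eu].
  apply/exit_time_after; exists u => //; apply: le_lt_trans ju.
  by rewrite /= ler_wpM2r// ler_nat.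
have mI : measurable (\bigcap_j F j) by exact: bigcap_measurable.
have cv : law P pi (F j) @[j --> \oo] --> law P pi (\bigcap_j F j).
  apply: nonincreasing_cvg_mu => //.
  by rewrite (le_lt_trans (law_le1 P (mF 0%N) (@probability_setT _ _ _ pi)))// ltry.
have <- : law P pi (\bigcap_j F j) = law P pi [set w | tau A (~` A) 1 w < +oo].
  rewrite -(cvg_lim _ cv)//; under eq_fun do rewrite lawF.
  by rewrite lim_cst.
move=> /eqP n0; case: (erg mI) => [|/n0//|//].
apply/seteqP; split => w /= Fw j _; apply/exit_time_after.
(* The shift accounts for one [t0], hence the predecessor; at [j = 0] it is enough that [t0 + u] is
   positive. *)
- have [u uj eu] := (exit_time_after A _ _).1 (Fw (j.-1) I).
  have u0 : (0 < u%:num)%R by rewrite (le_lt_trans _ uj).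
  exists (t0%:num + u%:num)%:nng%R; last exact/exit_time_shift.
  case: j uj => [|j] uj; first by rewrite /= mul0r addr_gt0.
  by rewrite /= -natr1 mulrDl mul1r addrC ltrD2l.
- have /exit_time_after[u uj eu] := Fw j.+1 I.
  have d0 : (0 < u%:num - t0%:num)%R.
    rewrite subr_gt0; apply: le_lt_trans uj.
    by rewrite /= -natr1 mulrDl mul1r lerDr.
  exists (NngNum (ltW d0)).
    by rewrite /= ltrBrDr; move: uj; rewrite /= -natr1 mulrDl mul1r.
  apply/exit_time_shift => //.
  by rewrite (_ : _%:nng%R = u)//; apply/val_inj; rewrite /= subrKC.
Qed.

End recurrence.

(** * Exit times clipped at a fixed level *)

Section clipped_exit_times.
Context {R : realType} {S : completeMetricType R}.
Variable A : set (borel S).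
Implicit Types (w : path_space S) (t c : R).

(* Increments of clipped exit times telescope, also when some are infinite. *)
Definition clip c n w : R := fine (Order.min (tau A (~` A) n w) c%:E).

Lemma clipE c n w : (clip c n w)%:E = Order.min (tau A (~` A) n w) c%:E.
Proof.
rewrite fineK//; have := tau_ge0 A n w.
case: (tau A (~` A) n w) => [x _| _|//].
  by rewrite -EFin_min.
by rewrite min_r ?leey.
Qed.

Lemma clip_ge0 c n w : (0 <= c)%R -> (0 <= clip c n w)%R.
Proof. by move=> c0; rewrite -lee_fin clipE le_min tau_ge0 lee_fin. Qed.

Lemma clip_le c n w : (clip c n w <= c)%R.
Proof. by rewrite -lee_fin clipE ge_min lexx orbT. Qed.

Lemma clip_leS c n w : (clip c n w <= clip c n.+1 w)%R.
Proof. by rewrite -lee_fin !clipE le_min !ge_min tau_leS lexx orbT. Qed.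

Lemma clip_id c n w : tau A (~` A) n w <= c%:E -> (clip c n w)%:E = tau A (~` A) n w.
Proof. by move=> h; rewrite clipE min_l. Qed.

Lemma clip_max c n w : c%:E <= tau A (~` A) n w -> clip c n w = c.
Proof. by move=> h; apply: EFin_inj; rewrite clipE min_r. Qed.

Lemma sum_clip c N w :
  (\sum_(0 <= n < N) (clip c n.+2 w - clip c n.+1 w) =
   clip c N.+1 w - clip c 1 w)%R.
Proof. by rewrite (telescope_sumr (fun n => clip c n.+1 w)). Qed.

(** As the exit occurs by [t], a next exit at most [L] later is not affected by clipping at [t + L],
    and a later one leaves an increment of at least [L]. *)
Lemma gap_le_clip t L n w : (0 <= L)%R -> tau A (~` A) n w <= t%:E ->
  Order.min (tau A (~` A) 1 (time_shift (time_of (tau A (~` A) n w)) w)) L%:E <=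
  (clip (t + L) n.+1 w - clip (t + L) n w)%:E.
Proof.
move=> L0 nt.
have nE := tau_num (le_lt_trans nt (ltry _)).
have := tau_shift 1 nE; rewrite addn1.
set a := (time_of _)%:num; set x := tau _ _ 1 _ => SE.
have x0 : 0 <= x by exact: tau_ge0.
have at_ : (a <= t)%R by rewrite -lee_fin /a -nE.
have ca : (clip (t + L) n w = a)%R.
  by apply: EFin_inj; rewrite clip_id -?nE// (le_trans nt)// lee_fin lerDl.
rewrite EFinB clipE SE ca.
case: x x0 {SE} => [x| |//] x0.
- rewrite -EFinD -!EFin_min -EFinB lee_fin lerBrDr.
  by rewrite le_min !addr_minl !ge_min [(x + a)%R]addrC lexx/= [(L + a)%R]addrC lerD2r at_ orbT.
- by rewrite addey// !min_r ?leey// -EFinB lee_fin lerBrDr addrC lerD2r.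
Qed.

Lemma clip_le_gap t n w : tau A (~` A) n w <= t%:E ->
  (clip t n.+1 w - clip t n w)%:E <=
  tau A (~` A) 1 (time_shift (time_of (tau A (~` A) n w)) w).
Proof.
move=> nt.
have nE := tau_num (le_lt_trans nt (ltry _)).
have := tau_shift 1 nE; rewrite addn1 => SE.
rewrite EFinB leeBlDr// (clip_id nt) addeC [X in _ <= X + _]nE -SE clipE.
by rewrite ge_min lexx.
Qed.

End clipped_exit_times.

(** * Upper and lower bounds for the mean exit time *)

Section mean_exit_time.
Context {R : realType} {S : completeMetricType R}.
Variables (P : R.-pker (borel S) ~> (path_space S)).
Hypothesis markovP : strong_markov_process P.
Variable q : R.-ker (borel S) ~> (borel S).
Hypothesis rateq : transition_rate_kernel P q.
Variable pi : probability (borel S) R.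
Hypothesis statpi : stationary_distribution P pi.
Variables (A : set (borel S)) (mA : measurable A).
Hypothesis rate_gt0 : 0 < exit_rate q pi A.
Hypothesis rate_fin : exit_rate q pi A < +oo.

Local Notation rate := (exit_rate q pi A).
Local Notation mu := (exit_distribution q pi mA).
Local Notation r := (fine rate).

Let r_gt0 : (0 < r)%R.
Proof. by rewrite fine_gt0// rate_gt0. Qed.

Let rateE : rate = r%:E.
Proof. by rewrite fineK// ge0_fin_numE// ltW. Qed.

Let D (t : {nonneg R}) n : set (path_space S) :=
  [set w | tau A (~` A) n.+1 w <= t%:num%:E].

Let shift n (w : path_space S) : path_space S :=
  time_shift (time_of (tau A (~` A) n.+1 w)) w.

(** Extension by zero turns integrals over events varying with [n] into integrals over one space,
    where sum and integral can be exchanged. *)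
Let gap (g : path_space S -> \bar R) t n := (g \o shift n) \_ (D t n).

Let gap_ge0 g t n w : (forall w, 0 <= g w) -> 0 <= gap g t n w.
Proof. by move=> g0; rewrite /gap /patch; case: ifP => // _; exact: g0. Qed.

Let measurable_gap g t n : measurable_fun setT g -> measurable_fun setT (gap g t n).
Proof.
move=> mg; apply/(measurable_restrictT _ (measurable_tau_le t n.+1 mA)).
apply: measurable_funTS; apply: measurableT_comp => //.
exact: measurable_shift_tau.
Qed.

Let measurable_gap_series g t : measurable_fun setT g -> (forall w, 0 <= g w) ->
  measurable_fun setT (fun w => \sum_(n <oo) gap g t n w).
Proof.
move=> mg g0; apply: (@ge0_emeasurable_sum _ _ _ setT (gap g t) xpredT) => n.
  by move=> w _ _; exact: gap_ge0.
by move=> _; exact: measurable_gap.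
Qed.

Let palm_series g t : (0 < t%:num)%R ->
  measurable_fun setT g -> (forall w, 0 <= g w) ->
  t%:num%:E * (rate * \int[law P mu]_w g w) =
  \int[law P pi]_w (\sum_(n <oo) gap g t n w).
Proof.
move=> t0 mg g0; rewrite integral_nneseries//; last 2 first.
- by move=> n; exact: measurable_gap.
- by move=> n w _; exact: gap_ge0.
rewrite (palm_integral markovP rateq statpi mA rate_gt0 rate_fin)//.
by apply: eq_eseriesr => n _; rewrite /gap -integral_mkcond.
Qed.

Let measurable_clipped (L : R) : measurable_fun setT
  (fun w => Order.min (tau A (~` A) 1 w) L%:E).
Proof. by apply: measurable_mine => //; exact: measurable_tau. Qed.

(** The gaps after the exits up to [t], each cut at [L], add up to at most [t + L] by telescoping,
    and their sum has mean [t r E]. Letting [t] tend to infinity removes [L]. *)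
Lemma mean_clipped_exit (L : R) : (0 <= L)%R ->
  \int[law P mu]_w Order.min (tau A (~` A) 1 w) L%:E <= (r^-1)%:E.
Proof.
move=> L0; set E := (X in X <= _).
have g0 w : 0 <= Order.min (tau A (~` A) 1 w) L%:E.
  by rewrite le_min tau_ge0 lee_fin.
have E0 : 0 <= E by exact: integral_ge0.
have key (t : {nonneg R}) : (0 < t%:num)%R -> t%:num%:E * (rate * E) <= (t%:num + L)%:E.
  move=> t0; rewrite palm_series//.
  have tL0 : (0 <= t%:num + L)%R by rewrite addr_ge0.
  rewrite (@le_trans _ _ (\int[law P pi]_w (t%:num + L)%:E))//; last first.
    rewrite integral_cst// -[leRHS]mule1 lee_wpmul2l// ?lee_fin//.
    exact: (law_le1 P measurableT (@probability_setT _ _ _ pi)).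
  apply: ge0_le_integral => //.
  - by move=> w _; apply: nneseries_ge0 => n _ _; exact: gap_ge0.
  - exact: measurable_gap_series.
  move=> w _; apply: lime_le.
    by apply: is_cvg_nneseries => n _ _; exact: gap_ge0.
  apply: nearW => N.
  rewrite (@le_trans _ _ (\sum_(0 <= n < N)
      (clip A (t%:num + L) n.+2 w - clip A (t%:num + L) n.+1 w)%:E))//.
    apply: lee_sum => n _; rewrite /gap /patch; case: ifPn => [|_].
      by rewrite inE => nt; exact: gap_le_clip.
    by rewrite lee_fin subr_ge0 clip_leS.
  rewrite sumEFin sum_clip lee_fin lerBlDr (le_trans (clip_le _ _ _ _))//.
  by rewrite lerDl clip_ge0.
have fE : E \is a fin_num.
  have := key (NngNum ler01) ltr01; rewrite /= mul1e rateE.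
  case: E E0 {key} => [//| |//] _.
  by rewrite gt0_muley ?lte_fin.
rewrite -(fineK fE) lee_fin -[leRHS]mulr1 ler_pdivlMl//.
apply: (@le_of_linear_bound _ _ _ L) => t t0.
rewrite mulr1 addrC -lee_fin !EFinM -rateE (fineK fE).
exact: key (NngNum (ltW t0)) t0.
Qed.

(** Fatou's lemma along the levels [L = n]. *)
Lemma mean_exit_le : \int[law P mu]_w tau_ex A w <= (r^-1)%:E.
Proof.
pose g (n : nat) (w : path_space S) := Order.min (tau A (~` A) 1 w) n%:R%:E.
have mg n : measurable_fun setT (g n) by exact: measurable_clipped.
have g0 n w : 0 <= g n w by rewrite /g le_min tau_ge0 lee_fin ler0n.
rewrite (@le_trans _ _ (\int[law P mu]_w limn_einf (g ^~ w)))//.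
  apply: ge0_le_integral => //.
  - by move=> w _; exact: tau_ge0.
  - exact: measurable_tau.
  - exact: measurable_fun_limn_einf.
  move=> w _; rewrite /tau_ex.
  have := tau_ge0 A 1 w; rewrite /g; case: (tau A (~` A) 1 w) => [x| |//] _.
    apply: near_ge_limn_einf; near=> n.
    rewrite le_min lexx lee_fin /=.
    by near: n; exact: nbhs_infty_ger.
  rewrite (@eq_infty _ (limn_einf _))// => x.
  apply: near_ge_limn_einf; near=> n.
  rewrite le_min leey lee_fin /=.
  by near: n; exact: nbhs_infty_ger.
apply: le_trans (fatou _ _ _ _) _ => //.
apply: limn_einf_le => n; exact: mean_clipped_exit.
Unshelve. all: by end_near.
Qed.

(** The gaps after the exits up to [t] cover the time from the first exit to [t], which is at least
    [t - s] if that exit occurs by [s]. Hence [(t - s) p <= t r E], and [t] tends to infinity. *)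
Lemma mean_exit_ge (s : {nonneg R}) :
  law P pi [set w | tau A (~` A) 1 w <= s%:num%:E] <=
  rate * \int[law P mu]_w tau_ex A w.
Proof.
set E := \int[_]_w _; set p := law _ _ _.
have E0 : 0 <= E by apply: integral_ge0 => w _; exact: tau_ge0.
have fE : E \is a fin_num.
  by rewrite ge0_fin_numE// (le_lt_trans mean_exit_le)// ltry.
have mT := measurable_tau_le s 1 mA.
have fp : p \is a fin_num.
  rewrite ge0_fin_numE ?measure_ge0// (le_lt_trans _ (ltry 1%R))//.
  exact: law_le1 (@probability_setT _ _ _ pi).
have p0 : (0 <= fine p)%R by rewrite fine_ge0// measure_ge0.
rewrite rateE -(fineK fE) -(fineK fp) -EFinM lee_fin.
apply: (@le_of_linear_bound _ _ _ (s%:num * fine p)%R) => t t0.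
pose t' : {nonneg R} := NngNum (ltW t0).
rewrite -lerBlDl -mulrBl -lee_fin !EFinM -rateE (fineK fE) (fineK fp).
(* For [t <= s] the left-hand side is nonpositive. *)
have [ts|st] := leP t s%:num.
  apply: (@le_trans _ _ 0).
    by rewrite mule_le0_ge0 ?lee_fin ?subr_le0 ?measure_ge0.
  by apply: mule_ge0; [rewrite lee_fin ltW|apply: mule_ge0 => //; exact: ltW].
rewrite (palm_series (t := t'))//; last 2 first.
- exact: measurable_tau.
- by move=> w; exact: tau_ge0.
pose early : set (path_space S) := [set w | tau A (~` A) 1 w <= s%:num%:E].
have -> : p = \int[law P pi]_w (\1_early w)%:E.
  by rewrite integral_indic// setIT.
have ts0 : (0 <= t - s%:num)%R by rewrite subr_ge0 ltW.
have mI : measurable_fun setT (fun w => (\1_early w)%:E : \bar R).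
  exact/measurable_EFinP/measurable_indic.
rewrite -ge0_integralZl//; apply: ge0_le_integral => //.
- by move=> w _; rewrite -EFinM lee_fin mulr_ge0.
- exact: emeasurable_funM.
- by apply: measurable_gap_series; [exact: measurable_tau|move=> w; exact: tau_ge0].
(* Beyond [N] exits the clipped time equals [t], so finitely many gaps suffice. *)
move=> w _; have [N tN] := tau_unbounded A w t.
apply: (@le_trans _ _ (\sum_(0 <= n < N) gap (tau A (~` A) 1) t' n w)); last first.
  by apply: nneseries_lim_ge => n _ _; apply: gap_ge0 => v; exact: tau_ge0.
rewrite (@le_trans _ _ (\sum_(0 <= n < N)
    (clip A t n.+2 w - clip A t n.+1 w)%:E))//; last first.
  apply: lee_sum => n _; rewrite /gap /patch; case: ifPn => [|].
    by rewrite inE => nt; exact: clip_le_gap.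
  (* For an exit after [t] both clipped times equal [t], so the increment vanishes. *)
  rewrite notin_setE /D /= => /negP; rewrite -ltNge => /ltW tn.
  by rewrite !clip_max ?subrr//; apply: le_trans tn (tau_leS _ _ _).
rewrite sumEFin sum_clip -EFinM lee_fin.
rewrite [X in (_ <= X - _)%R]clip_max; last first.
  exact: le_trans (ltW tN) (tau_leS _ _ _).
rewrite indicE; case: (boolP (w \in _)) => [|_]; last first.
  by rewrite mulr0 subr_ge0 clip_le.
rewrite inE /= => ws; rewrite mulr1 lerD2l lerN2 -lee_fin clip_id//.
by rewrite (le_trans ws)// lee_fin ltW.
Qed.

(** Otherwise the mean number of exits in [[0, 1]], which is the exit rate, would be 0. *)
Lemma exit_possible : law P pi [set w | tau A (~` A) 1 w < +oo] != 0.
Proof.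
apply/eqP => F0.
have := exit_count markovP rateq statpi mA rate_gt0 rate_fin
  (t := NngNum ler01) ltr01 measurableT.
rewrite eseries0.
  by rewrite exit_distributionT// mule1 mul1e => r0; move: rate_gt0; rewrite -r0 ltxx.
move=> n _ _; apply/eqP; rewrite eq_le measure_ge0 andbT -F0.
apply: le_measure; rewrite ?inE; first exact: measurable_exit_event.
  exact: measurable_tau_fin.
move=> w [wt _] /=; apply: le_lt_trans (le_lt_trans wt (ltry _)).
exact: tau_mono.
Qed.

Lemma mean_exit (t0 : {nonneg R}) : (0 < t0%:num)%R ->
  ergodic (law P pi) (time_shift t0) ->
  \int[law P mu]_w tau_ex A w = (r^-1)%:E.
Proof.
move=> t0_gt0 erg; apply/eqP; rewrite eq_le mean_exit_le/=.
have r0 : r != 0%R by rewrite gt_eqF.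
set E := \int[_]_w _.
have E0 : 0 <= E by apply: integral_ge0 => w _; exact: tau_ge0.
have fE : E \is a fin_num.
  by rewrite ge0_fin_numE// (le_lt_trans mean_exit_le)// ltry.
suff h : (1 <= r * fine E)%R.
  by rewrite -(fineK fE) lee_fin -[leLHS]mulr1 ler_pdivrMl.
rewrite -lee_fin EFinM -rateE (fineK fE).
(* The probability 1 of an exit is the limit of those of an exit by time [n], each at most [r E]. *)
rewrite -(exit_almost_surely markovP statpi mA t0_gt0 erg exit_possible).
pose F n := [set w | tau A (~` A) 1 w <= n%:R%:E].
have mF n : measurable (F n) by exact: (measurable_tau_le n%:R%:nng%R).
have UF : [set w | tau A (~` A) 1 w < +oo] = \bigcup_n F n.
  apply/seteqP; split => w /=.
    move=> woo; have [n _ wn] : \forall n \near \oo,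
        ((time_of (tau A (~` A) 1 w))%:num <= n%:R)%R.
      exact: nbhs_infty_ger.
    by exists n => //; rewrite /F /= tau_num// lee_fin; exact: (wn n (leqnn n)).
  by move=> [n _]; rewrite /F /= => h; rewrite (le_lt_trans h)// ltry.
have cv : law P pi (F n) @[n --> \oo] --> law P pi (\bigcup_n F n).
  apply: nondecreasing_cvg_mu => //; first exact: bigcup_measurable.
  move=> n m nm; apply/subsetPset => w; rewrite /F /= => h.
  by rewrite (le_trans h)// lee_fin ler_nat.
rewrite UF -(cvg_lim _ cv)//; apply: lime_le; first by apply/cvg_ex; eexists; exact: cv.
by apply: nearW => n; exact: (mean_exit_ge n%:R%:nng%R).
Qed.

End mean_exit_time.

(** * Infinite exit rate, and conclusion *)

Lemma exit_distribution_eq0 (R : realType) (S : completeMetricType R)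
    (q : R.-ker (borel S) ~> (borel S)) (pi : probability (borel S) R)
    (A : set (borel S)) (mA : measurable A) (B : set (borel S)) :
  exit_rate q pi A = +oo -> exit_distribution q pi mA B = 0.
Proof. by rewrite /exit_distribution => ->; rewrite invey mule0. Qed.

Lemma law_eq0 (R : realType) (S : completeMetricType R)
    (P : R.-pker (borel S) ~> (path_space S))
    (psi : {measure set (borel S) -> \bar R}) (G : set (path_space S)) :
  (forall B, psi B = 0) -> law P psi G = 0.
Proof.
move=> psi0; rewrite /law (eq_measure_integral mzero) ?integral_measure_zero//.
by move=> B _ _; exact: psi0.
Qed.

Unset Implicit Arguments.

Theorem proposition2p2 (R : realType) (S : completeMetricType R)
  (sepS : separable_space S)
  (P : R.-pker (borel S) ~> (path_space S))
  (markovP : strong_markov_process P)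
  (q : R.-ker (borel S) ~> (borel S))
  (rateq : transition_rate_kernel P q)
  (pi : probability (borel S) R)
  (statpi : stationary_distribution P pi)
  (A : set (borel S)) (mA : measurable A)
  (t0 : {nonneg R}) (t0_gt0 : (0 < t0%:num)%R)
  (erg : ergodic (law P pi) (time_shift t0))
  (exit_gt0 : 0 < exit_rate q pi A) :
  stationary_for_exits P A (exit_distribution q pi mA) /\
  (uniformly_integrable (law P (exit_distribution q pi mA))
     (fun n w => tau A (~` A) n.+1 w / n.+1%:R%:E) ->
   \int[law P (exit_distribution q pi mA)]_w tau_ex A w =
     1 / exit_rate q pi A).
Proof.
(* For an infinite rate the convention that the inverse of [+oo] is 0 makes [mu] and the law under
   it null, so both equations read [0 = 0]. *)
have [rate_oo|] := eqVneq (exit_rate q pi A) +oo.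
  have mu0 B : exit_distribution q pi mA B = 0 by exact: exit_distribution_eq0.
  split=> [n B _ _|_].
    by apply: etrans (esym (mu0 B)); exact: law_eq0.
  rewrite rate_oo invey mule0 (eq_measure_integral mzero).
    exact: integral_measure_zero.
  by move=> G _ _; exact: law_eq0.
rewrite -ltey => rate_fin; split.
  exact: (stationary_exits _ rateq).
move=> _; rewrite (mean_exit markovP rateq statpi mA exit_gt0 rate_fin t0_gt0 erg).
have fr : exit_rate q pi A \is a fin_num by rewrite ge0_fin_numE// ltW.
rewrite mul1e -[in RHS](fineK fr) inver ifF//.
by apply/negbTE; rewrite gt_eqF// fine_gt0// exit_gt0.
Qed.
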